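(* Let $(A, u, \eta, \Delta, \varepsilon, \{\cdot,\cdot\}, d)$ be a DG Poisson bialgebra over $\Bbbk$ (with Poisson bracket of degree $0$), and let $(A^e, m, h, d^e)$ be the universal enveloping algebra of the DG Poisson algebra $(A, \{\cdot,\cdot\}, d)$, with multiplication $u^e$, unit $\eta^e$ and differential $d^e$. Then there are maps $\Delta^e: A^e\to A^e\otimes A^e$ and $\varepsilon^e: A^e\to\Bbbk$ such that $(A^e, u^e, \eta^e, \Delta^e, \varepsilon^e, d^e)$ is a DG bialgebra and $$\Delta^e m=(m\otimes m)\Delta,\qquad \Delta^e h=(m\otimes h+h\otimes m)\Delta,\qquad \varepsilon^e m=\varepsilon,\qquad \varepsilon^e h=0.$$
   Context: Conventions: $\Bbbk$ is a field of characteristic zero; all gradings are $\mathbb{Z}$-gradings; algebras are associative with identity; $|a|$ is the degree of a homogeneous element $a$; the tensor product of graded algebras has multiplication $(a\otimes b)(a'\otimes b')=(-1)^{|a'||b|}aa'\otimes bb'$; the twisting map is $T(v\otimes w)=(-1)^{|v||w|}w\otimes v$; $I$ is the identity map. Sweedler notation $\Delta(a)=a_{(1)}\otimes a_{(2)}$ (summation omitted) is used. The Poisson brackets have degree $0$. DG algebra: a graded algebra with a $\Bbbk$-linear map $d$ of degree $1$ such that $d^2=0$ and $d(ab)=d(a)b+(-1)^{|a|}a\,d(b)$. A DG algebra map is a degree $0$ graded algebra map commuting with differentials. The field $\Bbbk$ is a DG algebra with zero differential. On a tensor product, $d(a\otimes b)=d(a)\otimes b+(-1)^{|a|}a\otimes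 d(b)$. DG Poisson algebra: a graded algebra $A$ with a $\Bbbk$-linear bracket $\{\cdot,\cdot\}:A\otimes A\to A$ of degree $0$ and a $\Bbbk$-linear map $d$ of degree $1$ with $d^2=0$ such that for all homogeneous $a,b,c$: $\{a,b\}=-(-1)^{|a||b|}\{b,a\}$; $\{a,\{b,c\}\}=\{\{a,b\},c\}+(-1)^{|a||b|}\{b,\{a,c\}\}$; $ab=(-1)^{|a||b|}ba$; $\{a,bc\}=\{a,b\}c+(-1)^{|a||b|}b\{a,c\}$; $d(\{a,b\})=\{d(a),b\}+(-1)^{|a|}\{a,d(b)\}$; $d(ab)=d(a)b+(-1)^{|a|}a\,d(b)$. Graded bialgebra: a graded algebra $(H,u,\eta)$ which is also a graded coalgebra $(H,\Delta,\varepsilon)$ (coassociative and counital, $\Delta,\varepsilon$ of degree $0$) such that $\Delta$ and $\varepsilon$ are graded algebra homomorphisms. DG bialgebra: a graded bialgebra $H$ with a $\Bbbk$-linear map $d$ of degree $1$, $d^2=0$, such that $d$ is a derivation ($d(ab)=d(a)b+(-1)^{|a|}a\,d(b)$) and a coderivation ($\varepsilon d=0$ and $\Delta d=(d\otimes I+T(d\otimes I)T)\Delta$). DG Poisson bialgebra $(A,u,\eta,\Delta,\varepsilon,\{\cdot,\cdot\},d)$: $(A,u,\eta,\{\cdot,\cdot\},d)$ is a DG Poisson algebra, $(A,u,\eta,\Delta,\varepsilon)$ is a graded bialgebra, $\Delta(\{a,b\})=\{\Delta(a),\Delta(b)\}_{A\otimes A}$ where $\{a\otimes a',b\otimes b'\}_{A\otimes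 A}=(-1)^{|b||a'|}(\{a,b\}\otimes a'b'+ab\otimes\{a',b'\})$, and $\varepsilon d=0$, $\Delta d(a)=d(a_{(1)})\otimes a_{(2)}+(-1)^{|a_{(1)}|}a_{(1)}\otimes d(a_{(2)})$. Universal enveloping algebra of a DG Poisson algebra $A$: a quadruple $(A^e,m,h,d^e)$ where $(A^e,d^e)$ is a DG algebra, $m:A\to A^e$ is a DG algebra map, $h:A\to A^e$ is a DG Lie algebra map (i.e. $h$ is linear of degree $0$, $d^eh=hd$, and $h(\{a,b\})=h(a)h(b)-(-1)^{|a||b|}h(b)h(a)$), satisfying $m(\{a,b\})=h(a)m(b)-(-1)^{|a||b|}m(b)h(a)$ and $h(ab)=m(a)h(b)+(-1)^{|a||b|}m(b)h(a)$ for homogeneous $a,b$, and universal: for every DG algebra $(D,\delta)$, DG algebra map $f:A\to D$ and DG Lie algebra map $g:A\to D$ (with $D$ carrying the graded commutator) with $f(\{a,b\})=g(a)f(b)-(-1)^{|a||b|}f(b)g(a)$ and $g(ab)=f(a)g(b)+(-1)^{|a||b|}f(b)g(a)$, there is a unique DG algebra map $\phi:A^e\to D$ with $\phi m=f$ and $\phi h=g$. Such an $A^e$ exists and is unique up to isomorphism. *)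

(* Defs.v *)
From HB Require Import structures.
From mathcomp Require Import all_boot all_order all_algebra.
From mathcomp Require Import generic_quotient.
From mathcomp Require Import boolp classical_sets cardinality fsbigop.
From mathcomp.multinomials Require Import freeg.

Set Implicit Arguments.
Unset Strict Implicit.
Unset Printing Implicit Defensive.

Import GRing.Theory.
Local Open Scope ring_scope.
Local Open Scope quotient_scope.
Local Open Scope classical_set_scope.

Section Tensor.
Variables (k : fieldType) (U V : lmodType k).
Implicit Types (u : U) (v : V) (c : k).

Local Notation free := {freeg (U * V)%type / k}.
Local Notation "<[ u , v ]>" := (<< (u, v) >> : free).

Inductive tens_rel : free -> Prop :=
| tens_rel0 : tens_rel 0
| tens_relD x y : tens_rel x -> tens_rel y -> tens_rel (x + y)
| tens_relZ c x : tens_rel x -> tens_rel (c *: x)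
| tens_rel_addl u u' v : tens_rel (<[u + u', v]> - <[u, v]> - <[u', v]>)
| tens_rel_addr u v v' : tens_rel (<[u, v + v']> - <[u, v]> - <[u, v']>)
| tens_rel_scalel c u v : tens_rel (<[c *: u, v]> - c *: <[u, v]>)
| tens_rel_scaler c u v : tens_rel (<[u, c *: v]> - c *: <[u, v]>).

Definition tens_relb : {pred free} := fun x => `[< tens_rel x >].

Lemma tens_rel_zmod_closed : zmod_closed tens_relb.
Proof.
split=> [|x y /asboolP xP /asboolP yP]; apply/asboolP; first exact: tens_rel0.
by rewrite -scaleN1r; apply: tens_relD => //; apply: tens_relZ.
Qed.

HB.instance Definition _ := GRing.isZmodClosed.Build free tens_relb
  tens_rel_zmod_closed.

Definition tens : Type := Quotient.quot tens_relb.
HB.instance Definition _ := GRing.Zmodule.on tens.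

Definition tens_pi (x : free) : tens := \pi_(Quotient.quot tens_relb) x.

Lemma tens_piE x y : tens_rel (x - y) <-> tens_pi x = tens_pi y.
Proof.
split=> [xy|/eqP].
  by apply/eqP; rewrite /tens_pi -Quotient.idealrBE; apply/asboolP.
by rewrite /tens_pi -Quotient.idealrBE => /asboolP.
Qed.

Lemma tens_piK (t : tens) : tens_pi (repr (t : Quotient.quot tens_relb)) = t.
Proof. by rewrite /tens_pi reprK. Qed.

Lemma tens_pi_is_zmod_morphism : zmod_morphism tens_pi.
Proof. by move=> x y; rewrite /tens_pi; exact: raddfB. Qed.

HB.instance Definition _ := GRing.isZmodMorphism.Build free tens tens_pi
  tens_pi_is_zmod_morphism.

Lemma tens_piD x y : tens_pi (x + y) = tens_pi x + tens_pi y.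
Proof. exact: raddfD. Qed.

Definition tens_scale c (t : tens) : tens :=
  tens_pi (c *: repr (t : Quotient.quot tens_relb)).

Lemma tens_scaleE c x : tens_scale c (tens_pi x) = tens_pi (c *: x).
Proof.
apply/tens_piE; rewrite -scalerBr; apply: tens_relZ.
by apply/tens_piE; rewrite tens_piK.
Qed.

Lemma tens_scaleA a b (t : tens) :
  tens_scale a (tens_scale b t) = tens_scale (a * b) t.
Proof. by rewrite -[t]tens_piK !tens_scaleE scalerA. Qed.

Lemma tens_scale1 : left_id 1 tens_scale.
Proof. by move=> t; rewrite -[t]tens_piK tens_scaleE scale1r. Qed.

Lemma tens_scaleDr : right_distributive tens_scale +%R.
Proof.
move=> c s t; rewrite -[s]tens_piK -[t]tens_piK -tens_piD !tens_scaleE.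
by rewrite scalerDr raddfD.
Qed.

Lemma tens_scaleDl t : {morph tens_scale^~ t : a b / a + b}.
Proof.
by move=> a b; rewrite -[t]tens_piK !tens_scaleE scalerDl raddfD.
Qed.

HB.instance Definition _ := GRing.Zmodule_isLmodule.Build k tens
  tens_scaleA tens_scale1 tens_scaleDr tens_scaleDl.

Lemma tens_piZ c x : tens_pi (c *: x) = c *: tens_pi x.
Proof. by rewrite -tens_scaleE. Qed.

Definition tpure u v : tens := tens_pi <[u, v]>.

Lemma tpureDl u u' v : tpure (u + u') v = tpure u v + tpure u' v.
Proof.
rewrite /tpure -tens_piD; apply/tens_piE; rewrite opprD addrA.
exact: tens_rel_addl.
Qed.

Lemma tpureDr u v v' : tpure u (v + v') = tpure u v + tpure u v'.
Proof.
rewrite /tpure -tens_piD; apply/tens_piE; rewrite opprD addrA.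
exact: tens_rel_addr.
Qed.

Lemma tpureZl c u v : tpure (c *: u) v = c *: tpure u v.
Proof. by rewrite /tpure -tens_piZ; apply/tens_piE/tens_rel_scalel. Qed.

Lemma tpureZr c u v : tpure u (c *: v) = c *: tpure u v.
Proof. by rewrite /tpure -tens_piZ; apply/tens_piE/tens_rel_scaler. Qed.

Lemma tpure_bilinear : bilinear_for *:%R *:%R tpure.
Proof.
by split=> [v c u u'|u c v v'] /=;
  rewrite ?(tpureDl, tpureZl) ?(tpureDr, tpureZr).
Qed.

End Tensor.

Arguments tens {k} (U V)%_type_scope.

Notation "U ⊗ V" := (tens U V) (at level 40, left associativity) : type_scope.
Notation "u ⊗ v" := (tpure u v) (at level 40, left associativity) : ring_scope.


Section TensorLift.
Variables (k : fieldType) (U V W : lmodType k).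
Implicit Type f : U -> V -> W.

Lemma fglift_linear (K : choiceType) (g : K -> W) :
  linear (fglift g : {freeg K / k} -> W).
Proof.
pose L : {additive {freeg K / k} -> W} := HB.pack (fglift g)
  (GRing.isZmodMorphism.Build _ _ (fglift g) (lift_is_additive g)).
move=> c x y; change (L (c *: x + y) = c *: L x + L y); rewrite raddfD.
congr (_ + _); rewrite -[x in RHS]freeg_sumE (_ : c *: x = fgscale c x) //.
rewrite /fgscale !(raddf_sum L) scaler_sumr.
by apply: eq_bigr => z _; rewrite /= !liftU scalerA.
Qed.

(* Meaningful only for bilinear [f]; see [tlift_pure] and [tlift_linear]. *)
Definition tlift f (t : U ⊗ V) : W :=
  fglift (fun uv => f uv.1 uv.2) (repr (t : Quotient.quot (@tens_relb k U V))).

Lemma tlift_pi f (x : {freeg (U * V)%type / k}) : bilinear_for *:%R *:%R f ->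
  tlift f (tens_pi x) = fglift (fun uv => f uv.1 uv.2) x.
Proof.
move=> [fl fr]; rewrite /tlift; set g := fun uv => _.
pose L : {linear {freeg (U * V)%type / k} -> W} := HB.pack (fglift g)
  (GRing.isLinear.Build _ _ _ _ (fglift g) (fglift_linear g)).
pose lf v : {linear U -> W} := HB.pack (f^~ v)
  (GRing.isLinear.Build _ _ _ _ (f^~ v) (fl v)).
pose rf u : {linear V -> W} := HB.pack (f u)
  (GRing.isLinear.Build _ _ _ _ (f u) (fr u)).
have gD y z : fglift g (y + z) = fglift g y + fglift g z by exact: (raddfD L).
have gB y z : fglift g (y - z) = fglift g y - fglift g z by exact: (raddfB L).
have gZ c y : fglift g (c *: y) = c *: fglift g y by exact: (linearZ_LR L).
have gE u v : fglift g << (u, v) >> = f u v by rewrite liftU scale1r.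
have flD u u' v : f (u + u') v = f u v + f u' v by exact: (raddfD (lf v)).
have frD u v v' : f u (v + v') = f u v + f u v' by exact: (raddfD (rf u)).
have flZ c u v : f (c *: u) v = c *: f u v by exact: (linearZ_LR (lf v)).
have frZ c u v : f u (c *: v) = c *: f u v by exact: (linearZ_LR (rf u)).
suff g0 y : tens_rel y -> fglift g y = 0.
  by apply/eqP; rewrite -subr_eq0 -gB; apply/eqP/g0/tens_piE; rewrite tens_piK.
elim=> {y} [|y z _ y0 _ z0|c y _ y0|u u' v|u v v'|c u v|c u v].
- exact: (raddf0 L).
- by rewrite gD y0 z0 addr0.
- by rewrite gZ y0 scaler0.
- by rewrite !gB !gE flD addrAC addrK subrr.
- by rewrite !gB !gE frD addrAC addrK subrr.
- by rewrite gB gZ !gE flZ subrr.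
- by rewrite gB gZ !gE frZ subrr.
Qed.

Lemma tlift_pure f u v : bilinear_for *:%R *:%R f -> tlift f (u ⊗ v) = f u v.
Proof. by move=> fB; rewrite tlift_pi // liftU scale1r. Qed.

Lemma tlift_linear f : bilinear_for *:%R *:%R f -> linear (tlift f).
Proof.
move=> fB c s t; rewrite -[s]tens_piK -[t]tens_piK -tens_piZ -tens_piD.
by rewrite !tlift_pi // fglift_linear.
Qed.

Lemma tens_sum (t : U ⊗ V) :
  exists s : seq (U * V), t = \sum_(p <- s) p.1 ⊗ p.2.
Proof.
rewrite -[t]tens_piK; move: (repr _) => x; rewrite -[x]freeg_sumE.
exists [seq (coeff z x *: z.1, z.2) | z <- dom x].
elim: (dom x) => [|[u v] r IHr] /=; first by rewrite !big_nil; exact: raddf0.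
rewrite !big_cons tens_piD IHr /= tpureZl /tpure -tens_piZ.
congr (tens_pi _ + _); apply/eqP/freeg_eqP => y.
by rewrite coeffZ !coeffU mul1r.
Qed.

End TensorLift.

(* The component V_n of the direct sum is the image of the projection
   [gpart n], i.e. [{v | homog n v}]; [\sum_(i \in [set: int])] is a sum with
   finite support. *)
HB.mixin Record isGraded (k : fieldType) V of GRing.Lmodule k V := {
  gpart : int -> {linear V -> V};
  gpartK : forall i j v, gpart i (gpart j v) = if i == j then gpart j v else 0;
  gpart_finite : forall v, finite_set [set i | gpart i v != 0];
  gpart_sum : forall v, \sum_(i \in [set: int]) gpart i v = v
}.

#[short(type="grModType")]
HB.structure Definition Graded (k : fieldType) :=
  {V of isGraded k V & GRing.Lmodule k V}.

Definition homog (k : fieldType) (V : grModType k) (n : int) (v : V) : Prop :=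
  gpart n v = v.

Definition degree0 (k : fieldType) (V W : grModType k) (f : V -> W) : Prop :=
  forall n v, homog n v -> homog n (f v).

Section GradedSums.
Variables (k : fieldType) (V : grModType k) (W : lmodType k).
Implicit Types (v : V) (F : int -> V -> W).

Lemma linear_eq0 (X Y : lmodType k) (f : X -> Y) : linear f -> f 0 = 0.
Proof.
by move=> fl; have := fl (-1) 0 0; rewrite scaler0 addr0 scaleN1r addNr.
Qed.

Lemma gpart_supp v :
  exists2 r : seq int, uniq r & forall i, i \notin r -> gpart i v = 0.
Proof.
have /finite_seqP [r vr] := gpart_finite v.
exists (undup r) => [|i]; first exact: undup_uniq.
rewrite mem_undup => ir; apply/eqP; apply: contraNT ir => vi.
by have : [set j | gpart j v != 0] i by []; rewrite vr.
Qed.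

Lemma gpart_supp2 v v' :
  exists r : seq int, [/\ uniq r, forall i, i \notin r -> gpart i v = 0
                        & forall i, i \notin r -> gpart i v' = 0].
Proof.
have [r _ rv] := gpart_supp v; have [r' _ rv'] := gpart_supp v'.
exists (undup (r ++ r')); split=> [|i|i]; rewrite ?undup_uniq //;
  rewrite mem_undup mem_cat negb_or => /andP[ir ir'].
- exact: rv.
- exact: rv'.
Qed.

Lemma gsumE F v (r : seq int) : (forall i, linear (F i)) ->
  uniq r -> (forall i, i \notin r -> gpart i v = 0) ->
  \sum_(i \in [set: int]) F i (gpart i v) = \sum_(i <- r) F i (gpart i v).
Proof.
move=> Fl ur rv; rewrite (fsbigE r) //= => [|i _ /rv ->].
  by apply: eq_bigl => i; rewrite in_setT.
exact: linear_eq0.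
Qed.

Lemma gsum_linear F : (forall i, linear (F i)) ->
  linear (fun v => \sum_(i \in [set: int]) F i (gpart i v)).
Proof.
move=> Fl c v v' /=; have [r [ur rv rv']] := gpart_supp2 v v'.
rewrite !(gsumE Fl ur) // => [|i ir].
  rewrite scaler_sumr -big_split; apply: eq_bigr => i _ /=.
  by rewrite linearP Fl.
by rewrite linearP rv // rv' // scaler0 addr0.
Qed.

Lemma gsum_homog F n v : (forall i, linear (F i)) -> homog n v ->
  \sum_(i \in [set: int]) F i (gpart i v) = F n v.
Proof.
move=> Fl vn; rewrite (gsumE Fl (r := [:: n])) //= => [|i].
  by rewrite big_seq1 vn.
by rewrite inE -vn gpartK => /negbTE ->.
Qed.

End GradedSums.

Section Koszul.
Variables (k : fieldType) (V W : grModType k) (X : lmodType k).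

(* The bilinear map sending (v, w) to (-1)^(|v||w|) f v w for v, w homogeneous;
   see [koszul_homog]. *)
Definition koszul (f : V -> W -> X) (v : V) (w : W) : X :=
  \sum_(i \in [set: int]) \sum_(j \in [set: int])
     (-1) ^ (i * j) *: f (gpart i v) (gpart j w).

Lemma koszulE f v w (r s : seq int) : bilinear_for *:%R *:%R f ->
    uniq r -> (forall i, i \notin r -> gpart i v = 0) ->
    uniq s -> (forall j, j \notin s -> gpart j w = 0) ->
  koszul f v w = \sum_(i <- r) \sum_(j <- s)
    (-1) ^ (i * j) *: f (gpart i v) (gpart j w).
Proof.
move=> [fl fr] ur rv us sw.
have lr i v' j : linear (fun w => (-1) ^ (i * j) *: f v' w).
  move=> c x y /=; rewrite fr scalerDr !scalerA; congr (_ *: _ + _).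
  exact: mulrC.
rewrite /koszul (fsbigE r) //= => [|i _ /rv ->]; last first.
  rewrite (gsumE (lr i 0) us sw) big1 // => j _.
  by rewrite (linear_eq0 (fl _)) scaler0.
rewrite (eq_bigl xpredT) => [|i]; last by rewrite in_setT.
by apply: eq_bigr => i _; rewrite (gsumE (lr i _) us sw).
Qed.

Lemma koszul_bilinear f :
  bilinear_for *:%R *:%R f -> bilinear_for *:%R *:%R (koszul f).
Proof.
move=> [fl fr].
have lr i j v : linear (fun w => (-1) ^ (i * j) *: f v w).
  move=> c w w' /=; rewrite fr scalerDr !scalerA; congr (_ *: _ + _).
  exact: mulrC.
have ll i w : linear (fun v => \sum_(j \in [set: int])
     (-1) ^ (i * j) *: f v (gpart j w)).
  move=> c v v' /=; have [r ur rw] := gpart_supp w.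
  rewrite !(gsumE (lr i ^~ _) ur rw) scaler_sumr -big_split.
  apply: eq_bigr => j _ /=; rewrite fl scalerDr !scalerA; congr (_ *: _ + _).
  exact: mulrC.
split=> [w|v] /=; first exact: (gsum_linear (ll ^~ w)).
move=> c w w'; have [r ur rv] := gpart_supp v.
rewrite /koszul !(gsumE (F := fun i v => \sum_(j \in [set: int])
   (-1) ^ (i * j) *: f v (gpart j _)) (ll ^~ _) ur rv) scaler_sumr -big_split.
apply: eq_bigr => i _ /=.
exact: (gsum_linear (F := fun j w => (-1) ^ (i * j) *: f (gpart i v) w)).
Qed.

Lemma koszul_homog f i j v w :
  bilinear_for *:%R *:%R f -> homog i v -> homog j w ->
  koszul f v w = (-1) ^ (i * j) *: f v w.
Proof.
move=> [fl fr] vi wj.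
have lr i' v' : linear (fun w => (-1) ^ (i' * j) *: f v' w).
  move=> c x y /=; rewrite fr scalerDr !scalerA; congr (_ *: _ + _).
  exact: mulrC.
rewrite /koszul; under eq_fsbigr => i' _.
  rewrite (@gsum_homog k W X (fun j' w => (-1) ^ (i' * j') *: f (gpart i' v) w) j) //.
    over.
  move=> j' c x y /=; rewrite fr scalerDr !scalerA; congr (_ *: _ + _).
  exact: mulrC.
apply: (@gsum_homog k V X (fun i' v' => (-1) ^ (i' * j) *: f v' w)) => //.
move=> i' c x y /=; rewrite fl scalerDr !scalerA; congr (_ *: _ + _).
exact: mulrC.
Qed.

End Koszul.

Section GradedSign.
Variables (k : fieldType) (V : grModType k).

(* v |-> (-1)^|v| v *)
Definition gsign (v : V) : V := \sum_(i \in [set: int]) (-1) ^ i *: gpart i v.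

Lemma gsign_linear : linear gsign.
Proof.
apply: (gsum_linear (F := fun i v => (-1) ^ i *: v)) => i c v w /=.
by rewrite scalerDr !scalerA mulrC.
Qed.

Lemma gsign_homog i v : homog i v -> gsign v = (-1) ^ i *: v.
Proof.
apply: (gsum_homog (F := fun i v => (-1) ^ i *: v)) => j c x w /=.
by rewrite scalerDr !scalerA mulrC.
Qed.

End GradedSign.

Section GradedTensor.
Variables (k : fieldType) (U V : grModType k).
Implicit Types (t : U ⊗ V) (n : int).

Lemma tens_homog_ind (P : U ⊗ V -> Prop) :
    P 0 -> (forall s t, P s -> P t -> P (s + t)) ->
    (forall i j u v, homog i u -> homog j v -> P (u ⊗ v)) ->
  forall t, P t.
Proof.
move=> P0 PD Ph t; have [s ->] := tens_sum t.
elim: s => [|[u v] s IHs]; rewrite ?big_nil ?big_cons //=; apply: (PD) => // {IHs}.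
have [ru uru uu] := gpart_supp u; have [rv urv vv] := gpart_supp v.
have uE := gsumE (F := fun _ => id) (fun _ _ _ _ => erefl) uru uu.
have vE := gsumE (F := fun _ => id) (fun _ _ _ _ => erefl) urv vv.
rewrite gpart_sum in uE; rewrite gpart_sum in vE; rewrite uE vE {uE vE}.
elim: ru {uru uu} => [|i ru IHu]; rewrite ?big_nil ?big_cons.
  by rewrite -[0](scale0r 0) tpureZl scale0r.
rewrite tpureDl; apply: (PD) => // {IHu}.
elim: rv {urv vv} => [|j rv IHv]; rewrite ?big_nil ?big_cons.
  by rewrite -[0](scale0r 0) tpureZr scale0r.
rewrite tpureDr; apply: (PD) => //; apply: (Ph i j); rewrite /homog gpartK eqxx //.
Qed.

(* (U ⊗ V)_n is the sum of the U_i ⊗ V_(n - i). *)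
Definition tens_gpart n : U ⊗ V -> U ⊗ V :=
  tlift (fun u v => \sum_(i \in [set: int]) gpart i u ⊗ gpart (n - i) v).

Lemma tens_gpart_bilinear n : bilinear_for *:%R *:%R
  (fun u v => \sum_(i \in [set: int]) gpart i u ⊗ gpart (n - i) v : U ⊗ V).
Proof.
have ll v i : linear (fun u => u ⊗ gpart (n - i) v : U ⊗ V).
  by move=> c u u'; rewrite tpureDl tpureZl.
split=> [v|u c v v'] /=.
  exact: (gsum_linear (F := fun i u => u ⊗ gpart (n - i) v)).
have [r ur ru] := gpart_supp u.
rewrite !(gsumE (F := fun i u => u ⊗ gpart (n - i) _) (ll _) ur ru).
rewrite scaler_sumr -big_split; apply: eq_bigr => i _ /=.
by rewrite linearP tpureDr tpureZr.
Qed.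

HB.instance Definition _ n := GRing.isLinear.Build k
  (U ⊗ V)%type (U ⊗ V)%type _
  (tens_gpart n) (tlift_linear (tens_gpart_bilinear n)).

Lemma tens_gpart0 n : tens_gpart n 0 = 0. Proof. exact: linear0. Qed.

Lemma tens_gpartD n s t : tens_gpart n (s + t) = tens_gpart n s + tens_gpart n t.
Proof. exact: linearD. Qed.

Lemma tens_gpart_homog n i j u v : homog i u -> homog j v ->
  tens_gpart n (u ⊗ v) = if n == i + j then u ⊗ v else 0.
Proof.
move=> ui vj; rewrite /tens_gpart tlift_pure; last exact: tens_gpart_bilinear.
rewrite (gsum_homog (F := fun i u => u ⊗ gpart (n - i) v) _ ui); last first.
  by move=> l c x y; rewrite tpureDl tpureZl.
rewrite -vj gpartK subr_eq addrC; case: eqP => // _.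
by rewrite -[0](scale0r 0) tpureZr scale0r.
Qed.

Lemma tens_gpartK i j t :
  tens_gpart i (tens_gpart j t) = if i == j then tens_gpart j t else 0.
Proof.
move: t; apply: tens_homog_ind => [|s t IHs IHt|a b u v ua vb].
- by rewrite !tens_gpart0 if_same.
- by rewrite !tens_gpartD IHs IHt; case: eqP => // _; rewrite addr0.
rewrite !(tens_gpart_homog _ ua vb); have [->|_] := eqVneq j (a + b).
  by rewrite (tens_gpart_homog _ ua vb).
by rewrite tens_gpart0 if_same.
Qed.

Lemma tens_gpart_supp t :
  exists2 r : seq int, uniq r & forall i, i \notin r -> tens_gpart i t = 0.
Proof.
move: t; apply: tens_homog_ind => [|s t [r _ rs] [r' _ rt]|i j u v ui vj].
- by exists [::] => // i _; rewrite tens_gpart0.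
- exists (undup (r ++ r')) => [|i]; first exact: undup_uniq.
  rewrite mem_undup mem_cat negb_or tens_gpartD => /andP[ir ir'].
  by rewrite rs // rt // addr0.
exists [:: i + j] => // n; rewrite inE => /negbTE nE.
by rewrite (tens_gpart_homog _ ui vj) nE.
Qed.

Lemma tens_gpart_finite t : finite_set [set i | tens_gpart i t != 0].
Proof.
have [r _ rt] := tens_gpart_supp t.
apply: (@sub_finite_set _ _ [set` r]); last exact: finite_seq.
by move=> i /=; apply: contraR => /rt ->.
Qed.

Lemma tens_gpart_sumE t (r : seq int) : uniq r ->
    (forall i, i \notin r -> tens_gpart i t = 0) ->
  \sum_(i \in [set: int]) tens_gpart i t = \sum_(i <- r) tens_gpart i t.
Proof.
move=> ur rt; rewrite (fsbigE r) //= => [|i _ /rt //].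
by apply: eq_bigl => i; rewrite in_setT.
Qed.

Lemma tens_gpart_sum t : \sum_(i \in [set: int]) tens_gpart i t = t.
Proof.
move: t; apply: tens_homog_ind => [|s t IHs IHt|i j u v ui vj].
- by rewrite (@tens_gpart_sumE _ [::]) ?big_nil // => i _; rewrite tens_gpart0.
- have [r _ rs] := tens_gpart_supp s; have [r' _ rt] := tens_gpart_supp t.
  have mem i : i \notin undup (r ++ r') -> tens_gpart i s = 0 /\ tens_gpart i t = 0.
    by rewrite mem_undup mem_cat negb_or => /andP[/rs -> /rt ->].
  rewrite -[in RHS]IHs -[in RHS]IHt.
  rewrite !(@tens_gpart_sumE _ (undup (r ++ r'))) ?undup_uniq //.
  + by rewrite -big_split; apply: eq_bigr => i _ /=; rewrite tens_gpartD.
  + by move=> i /mem[].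
  + by move=> i /mem[].
  + by move=> i /mem[is0 it0]; rewrite tens_gpartD is0 it0 addr0.
rewrite (@tens_gpart_sumE _ [:: i + j]) // => [|n].
  by rewrite big_seq1 (tens_gpart_homog _ ui vj) eqxx.
by rewrite inE (tens_gpart_homog _ ui vj) => /negbTE ->.
Qed.

HB.instance Definition _ := isGraded.Build k (U ⊗ V)%type
  tens_gpartK tens_gpart_finite tens_gpart_sum.

End GradedTensor.

(* The ground field, concentrated in degree 0. *)
Section GradedField.
Variable k : fieldType.

Definition field_gpart (n : int) (x : k^o) : k^o := (n == 0)%:R *: x.

Lemma field_gpart_linear n : linear (field_gpart n).
Proof.
by move=> c x y; rewrite /field_gpart scalerDr !scalerA; congr (_ *: _ + _);
  rewrite mulrC.
Qed.

HB.instance Definition _ n := GRing.isLinear.Build k k^o k^o _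
  (field_gpart n) (field_gpart_linear n).

Lemma field_gpartK i j x :
  field_gpart i (field_gpart j x) = if i == j then field_gpart j x else 0.
Proof.
rewrite /field_gpart scalerA; have [->|ij] := eqVneq i j.
  by case: eqP; rewrite ?mulr1 ?mulr0.
suff -> : (i == 0)%:R * (j == 0)%:R = 0 :> k by rewrite scale0r.
by case: (i =P 0) ij => [->|_]; case: (j =P 0) => [->|_];
  rewrite ?eqxx ?mulr0 ?mul0r.
Qed.

Lemma field_gpart_finite x : finite_set [set i | field_gpart i x != 0].
Proof.
apply: (@sub_finite_set _ _ [set` [:: 0 : int]]); last exact: finite_seq.
move=> i /=; rewrite inE; apply: contraR => /negbTE i0.
by rewrite /field_gpart i0 scale0r.
Qed.

Lemma field_gpart_sum x : \sum_(i \in [set: int]) field_gpart i x = x.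
Proof.
rewrite (fsbigE [:: 0 : int]) //= => [|i _].
  by rewrite big_cons in_setT big_nil addr0 /field_gpart scale1r.
by rewrite inE /field_gpart => /negbTE ->; rewrite scale0r.
Qed.

HB.instance Definition _ := isGraded.Build k k^o
  field_gpartK field_gpart_finite field_gpart_sum.

End GradedField.

HB.mixin Record isGradedAlgebra (k : fieldType) A
    of Graded k A & GRing.Algebra k A := {
  homog1 : homog 0 (1 : A);
  homogM : forall i j (a b : A), homog i a -> homog j b -> homog (i + j) (a * b)
}.

#[short(type="grAlgType")]
HB.structure Definition GradedAlgebra (k : fieldType) :=
  {A of isGradedAlgebra k A & Graded k A & GRing.Algebra k A}.

HB.mixin Record isDGAlgebra (k : fieldType) A of GradedAlgebra k A := {
  diff : {linear A -> A};
  diff_homog : forall i (a : A), homog i a -> homog (i + 1) (diff a);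
  diff_diff : forall a : A, diff (diff a) = 0;
  diffM : forall i (a b : A), homog i a ->
    diff (a * b) = diff a * b + (-1) ^ i *: (a * diff b)
}.

#[short(type="dgAlgType")]
HB.structure Definition DGAlgebra (k : fieldType) :=
  {A of isDGAlgebra k A & GradedAlgebra k A}.

HB.mixin Record isDGPoisson (k : fieldType) A of DGAlgebra k A := {
  pbr : {bilinear A -> A -> A};
  pbr_homog : forall i j (a b : A), homog i a -> homog j b ->
    homog (i + j) (pbr a b);
  pbr_anti : forall i j (a b : A), homog i a -> homog j b ->
    pbr a b = - ((-1) ^ (i * j) *: pbr b a);
  pbr_jacobi : forall i j l (a b c : A), homog i a -> homog j b -> homog l c ->
    pbr a (pbr b c) = pbr (pbr a b) c + (-1) ^ (i * j) *: pbr b (pbr a c);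
  graded_mulC : forall i j (a b : A), homog i a -> homog j b ->
    a * b = (-1) ^ (i * j) *: (b * a);
  pbrM : forall i j l (a b c : A), homog i a -> homog j b -> homog l c ->
    pbr a (b * c) = pbr a b * c + (-1) ^ (i * j) *: (b * pbr a c);
  diff_pbr : forall i j (a b : A), homog i a -> homog j b ->
    diff (pbr a b) = pbr (diff a) b + (-1) ^ i *: pbr a (diff b)
}.

#[short(type="dgPoissonType")]
HB.structure Definition DGPoisson (k : fieldType) :=
  {A of isDGPoisson k A & DGAlgebra k A}.

Section TensorMaps.
Variable k : fieldType.

Definition tmap (U V U' V' : lmodType k) (f : U -> U') (g : V -> V') :
    U ⊗ V -> U' ⊗ V' :=
  tlift (fun u v => f u ⊗ g v).

Definition tassoc (U V W : lmodType k) : (U ⊗ V) ⊗ W -> U ⊗ (V ⊗ W) :=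
  tlift (fun x w => tlift (fun u v => u ⊗ (v ⊗ w)) x).

Definition twist (V W : grModType k) : V ⊗ W -> W ⊗ V :=
  tlift (koszul (fun v w => w ⊗ v)).

Lemma tlift_param (X U V W : lmodType k) (F : X -> U -> V -> W) (t : U ⊗ V) :
    (forall x, bilinear_for *:%R *:%R (F x)) ->
    (forall u v, linear (fun x => F x u v)) ->
  linear (fun x => tlift (F x) t).
Proof.
move=> FB Fl c x y /=; have [s ->] := tens_sum t.
elim: s => [|[u v] s IHs].
  by rewrite big_nil !(linear_eq0 (tlift_linear (FB _))) scaler0 addr0.
have tD z a b : tlift (F z) (a + b) = tlift (F z) a + tlift (F z) b.
  by rewrite -[a]scale1r (tlift_linear (FB z)) !scale1r.
rewrite big_cons !tD IHs !tlift_pure //= Fl scalerDr !addrA; congr (_ + _).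
by rewrite addrAC.
Qed.

Lemma tmap_bilinear (U V U' V' : lmodType k) (f : U -> U') (g : V -> V') :
  linear f -> linear g -> bilinear_for *:%R *:%R (fun u v => f u ⊗ g v).
Proof.
by move=> fl gl; split=> [v c u u'|u c v v'] /=;
  rewrite ?(fl, gl) ?(tpureDl, tpureZl) ?(tpureDr, tpureZr).
Qed.

Lemma tmap_pure (U V U' V' : lmodType k) (f : U -> U') (g : V -> V') u v :
  linear f -> linear g -> tmap f g (u ⊗ v) = f u ⊗ g v.
Proof. by move=> fl gl; rewrite /tmap tlift_pure //; exact: tmap_bilinear. Qed.

Lemma tassoc_pure (U V W : lmodType k) (u : U) (v : V) (w : W) :
  tassoc ((u ⊗ v) ⊗ w) = u ⊗ (v ⊗ w).
Proof.
have B w' : bilinear_for *:%R *:%R (fun (u : U) (v : V) => u ⊗ (v ⊗ w')).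
  by split=> [v' c x x'|x c y y'] /=;
    rewrite ?(tpureDl, tpureZl) ?(tpureDr, tpureZr).
rewrite /tassoc tlift_pure ?tlift_pure //; split=> [w'|x c y y'] /=.
  exact: tlift_linear.
apply: (tlift_param (F := fun w u v => u ⊗ (v ⊗ w))) => // {}u {}v d z z'.
by rewrite !tpureDr !tpureZr.
Qed.

Lemma twist_homog (V W : grModType k) i j (v : V) (w : W) :
  homog i v -> homog j w -> twist (v ⊗ w) = (-1) ^ (i * j) *: (w ⊗ v).
Proof.
have B : bilinear_for *:%R *:%R (fun (v : V) (w : W) => w ⊗ v).
  by split=> [v' c x x'|x c y y'] /=;
    rewrite ?(tpureDl, tpureZl) ?(tpureDr, tpureZr).
move=> vi wj; rewrite /twist tlift_pure; last exact: koszul_bilinear.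
exact: koszul_homog.
Qed.

End TensorMaps.

Section KoszulLift.
Variables (k : fieldType) (U : lmodType k) (V V' : grModType k).
Variables (U' X : lmodType k).

(* The bilinear extension of
   (u ⊗ v, v' ⊗ u') |-> (-1)^(|v||v'|) f u v v' u'; see [klift_homog]. *)
Definition klift (f : U -> V -> V' -> U' -> X) (x : U ⊗ V) (y : V' ⊗ U') : X :=
  tlift (fun u v => tlift (fun v' u' =>
    koszul (fun v v' => f u v v' u') v v') y) x.

Definition multilinear4 (f : U -> V -> V' -> U' -> X) : Prop :=
  [/\ forall v v' u', linear (fun u => f u v v' u'),
      forall u v' u', linear (fun v => f u v v' u'),
      forall u v u', linear (fun v' => f u v v' u')
    & forall u v v', linear (f u v v')].

Lemma koszul_param (Y : lmodType k) (F : Y -> V -> V' -> X) v v' :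
    (forall y, bilinear_for *:%R *:%R (F y)) ->
    (forall v v', linear (fun y => F y v v')) ->
  linear (fun y => koszul (F y) v v').
Proof.
move=> FB Fl c y z /=.
have [r ur rv] := gpart_supp v; have [s us sv'] := gpart_supp v'.
have E y' := koszulE (FB y') ur rv us sv'.
rewrite !E scaler_sumr -big_split; apply: eq_bigr => i _ /=.
rewrite scaler_sumr -big_split; apply: eq_bigr => j _ /=.
by rewrite Fl scalerDr !scalerA; congr (_ *: _ + _); rewrite mulrC.
Qed.

Variable f : U -> V -> V' -> U' -> X.
Hypothesis fM : multilinear4 f.

Let fB u u' : bilinear_for *:%R *:%R (fun v v' => f u v v' u').
Proof. by case: fM => f1 f2 f3 f4; split=> [v'|v]; [exact: f2 | exact: f3]. Qed.

Let inner_bilinear u v : bilinear_for *:%R *:%R (fun v' u' =>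
  koszul (fun v v' => f u v v' u') v v').
Proof.
case: fM => f1 f2 f3 f4; split=> [u'|v'].
  exact: (koszul_bilinear (fB u u')).2.
apply: (koszul_param (F := fun u' v v' => f u v v' u')) => [u'|w w'].
  exact: fB.
exact: f4.
Qed.

Let outer_bilinear y : bilinear_for *:%R *:%R (fun u v => tlift (fun v' u' =>
  koszul (fun v v' => f u v v' u') v v') y).
Proof.
case: fM => f1 f2 f3 f4; split=> [v|u].
  apply: (tlift_param (F := fun u v' u' =>
    koszul (fun v v' => f u v v' u') v v')) => [u|v' u'].
    exact: inner_bilinear.
  apply: (koszul_param (F := fun u v v' => f u v v' u')) => [u|w w'].
    exact: fB.
  exact: f1.
apply: (tlift_param (F := fun v v' u' =>
  koszul (fun v v' => f u v v' u') v v')) => [v|v' u'].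
  exact: inner_bilinear.
exact: (koszul_bilinear (fB u u')).1.
Qed.

Lemma klift_bilinear : bilinear_for *:%R *:%R (klift f).
Proof.
split=> [y|x]; first exact: (tlift_linear (outer_bilinear y)).
apply: (tlift_param (F := fun y u v => tlift (fun v' u' =>
  koszul (fun v v' => f u v v' u') v v') y)) => [y|u v].
  exact: outer_bilinear.
exact: (tlift_linear (inner_bilinear u v)).
Qed.

Lemma klift_homog i j u v v' u' : homog i v -> homog j v' ->
  klift f (u ⊗ v) (v' ⊗ u') = (-1) ^ (i * j) *: f u v v' u'.
Proof.
move=> vi v'j; rewrite /klift tlift_pure; last exact: outer_bilinear.
rewrite tlift_pure; last exact: inner_bilinear.
exact: koszul_homog (fB u u') vi v'j.
Qed.

End KoszulLift.

Section TensorAlgebra.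
Variables (k : fieldType) (A B : grAlgType k).

Definition tmul : A ⊗ B -> A ⊗ B -> A ⊗ B :=
  klift (fun a b a' b' => (a * a') ⊗ (b * b')).

Lemma tmul_multilinear :
  multilinear4 (fun (a : A) (b : B) (a' : A) (b' : B) => (a * a') ⊗ (b * b')).
Proof.
split=> [b a' b'|a a' b'|a b b'|a b a'] c x y.
- by rewrite mulrDl -scalerAl tpureDl tpureZl.
- by rewrite mulrDl -scalerAl tpureDr tpureZr.
- by rewrite mulrDr -scalerAr tpureDl tpureZl.
- by rewrite mulrDr -scalerAr tpureDr tpureZr.
Qed.

Lemma tmul_homog i j (a a' : A) (b b' : B) : homog i b -> homog j a' ->
  tmul (a ⊗ b) (a' ⊗ b') = (-1) ^ (i * j) *: ((a * a') ⊗ (b * b')).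
Proof. exact: (klift_homog tmul_multilinear). Qed.

End TensorAlgebra.

Section TensorPoisson.
Variables (k : fieldType) (A B : dgPoissonType k).

Definition tpbr : A ⊗ B -> A ⊗ B -> A ⊗ B :=
  klift (fun a a' b b' => pbr a b ⊗ (a' * b') + (a * b) ⊗ pbr a' b').

Lemma tpbr_multilinear : multilinear4 (fun (a : A) (a' : B) (b : A) (b' : B) =>
  pbr a b ⊗ (a' * b') + (a * b) ⊗ pbr a' b').
Proof.
have tL (u u' : A) (v : B) c : (c *: u + u') ⊗ v = c *: (u ⊗ v) + u' ⊗ v
  by rewrite tpureDl tpureZl.
have tR (u : A) (v v' : B) c : u ⊗ (c *: v + v') = c *: (u ⊗ v) + u ⊗ v'
  by rewrite tpureDr tpureZr.
split=> [a' b b'|a b b'|a a' b'|a a' b] c x y.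
- by rewrite linearPl mulrDl -scalerAl !tL scalerDr addrACA.
- by rewrite linearPl mulrDl -scalerAl !tR scalerDr addrACA.
- by rewrite linearPr mulrDr -scalerAr !tL scalerDr addrACA.
- by rewrite linearPr mulrDr -scalerAr !tR scalerDr addrACA.
Qed.

Lemma tpbr_homog i j (a b : A) (a' b' : B) : homog i a' -> homog j b ->
  tpbr (a ⊗ a') (b ⊗ b') =
    (-1) ^ (i * j) *: (pbr a b ⊗ (a' * b') + (a * b) ⊗ pbr a' b').
Proof. exact: (klift_homog tpbr_multilinear). Qed.

End TensorPoisson.

Section TensorDG.
Variables (k : fieldType) (A B : dgAlgType k).

Definition tdiff : A ⊗ B -> A ⊗ B :=
  tlift (fun a b => diff a ⊗ b + gsign a ⊗ diff b).

Lemma tdiff_homog i (a : A) (b : B) : homog i a ->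
  tdiff (a ⊗ b) = diff a ⊗ b + (-1) ^ i *: (a ⊗ diff b).
Proof.
move=> ai; rewrite /tdiff tlift_pure ?(gsign_homog ai) ?tpureZl //.
split=> [y c x x'|x c y y'] /=.
  rewrite linearP gsign_linear !tpureDl !tpureZl scalerDr.
  by rewrite addrACA.
by rewrite linearP !tpureDr !tpureZr scalerDr addrACA.
Qed.

End TensorDG.

Section Bialgebras.
Variable k : fieldType.

Record is_gr_bialgebra (H : grAlgType k)
    (Delta : {linear H -> (H ⊗ H)%type}) (eps : {linear H -> k^o}) : Prop :=
  GrBialgebra {
    bialg_coassoc : forall a : H,
      tassoc (tmap Delta idfun (Delta a)) = tmap idfun Delta (Delta a);
    bialg_counitl : forall a : H, tmap eps idfun (Delta a) = 1 ⊗ a;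
    bialg_counitr : forall a : H, tmap idfun eps (Delta a) = a ⊗ 1;
    bialg_Delta_degree0 : degree0 Delta;
    bialg_eps_degree0 : degree0 eps;
    bialg_Delta1 : Delta 1 = 1 ⊗ 1;
    bialg_DeltaM : forall a b : H, Delta (a * b) = tmul (Delta a) (Delta b);
    bialg_eps1 : eps 1 = 1;
    bialg_epsM : forall a b : H, eps (a * b) = eps a * eps b
  }.

Record is_dg_bialgebra (H : dgAlgType k)
    (Delta : {linear H -> (H ⊗ H)%type}) (eps : {linear H -> k^o}) : Prop :=
  DGBialgebra {
    dg_bialg_gr : is_gr_bialgebra Delta eps;
    dg_bialg_eps_diff : forall a : H, eps (diff a) = 0;
    dg_bialg_Delta_diff : forall a : H,
      Delta (diff a) = tmap diff idfun (Delta a)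
                       + twist (tmap diff idfun (twist (Delta a)))
  }.

Record is_dg_poisson_bialgebra (A : dgPoissonType k)
    (Delta : {linear A -> (A ⊗ A)%type}) (eps : {linear A -> k^o}) : Prop :=
  DGPoissonBialgebra {
    dgp_bialg_gr : is_gr_bialgebra Delta eps;
    dgp_bialg_Delta_pbr : forall a b : A,
      Delta (pbr a b) = tpbr (Delta a) (Delta b);
    dgp_bialg_eps_diff : forall a : A, eps (diff a) = 0;
    dgp_bialg_Delta_diff : forall a : A, Delta (diff a) = tdiff (Delta a)
  }.

End Bialgebras.

Section Enveloping.
Variable k : fieldType.

Definition dg_map (A D : dgAlgType k) (f : A -> D) : Prop :=
  degree0 f /\ forall a, f (diff a) = diff (f a).

(* [f] is a DG algebra map, [g] is a DG Lie algebra map into [D] with the graded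
   commutator, and the two are compatible. *)
Record enveloping_pair (A : dgPoissonType k) (D : dgAlgType k)
    (f : {lrmorphism A -> D}) (g : {linear A -> D}) : Prop := EnvelopingPair {
  env_dg_f : dg_map f;
  env_dg_g : dg_map g;
  env_lie : forall i j (a b : A), homog i a -> homog j b ->
    g (pbr a b) = g a * g b - (-1) ^ (i * j) *: (g b * g a);
  env_pbr : forall i j (a b : A), homog i a -> homog j b ->
    f (pbr a b) = g a * f b - (-1) ^ (i * j) *: (f b * g a);
  env_mul : forall i j (a b : A), homog i a -> homog j b ->
    g (a * b) = f a * g b + (-1) ^ (i * j) *: (f b * g a)
}.

(* [algType] excludes the zero ring, both for [Ae] and for the test algebras [D].
   The zero algebra satisfies the universal condition as a target trivially, and
   the enveloping algebra of a DG Poisson bialgebra is nonzero: the pair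
   (counit, 0) induces a unital map from it to the ground field. *)
Definition is_enveloping (A : dgPoissonType k) (Ae : dgAlgType k)
    (m : {lrmorphism A -> Ae}) (h : {linear A -> Ae}) : Prop :=
  enveloping_pair m h /\
  forall (D : dgAlgType k) (f : {lrmorphism A -> D}) (g : {linear A -> D}),
    enveloping_pair f g ->
    exists phi : {lrmorphism Ae -> D},
      [/\ dg_map phi, phi \o m =1 f & phi \o h =1 g] /\
      forall psi : {lrmorphism Ae -> D},
        [/\ dg_map psi, psi \o m =1 f & psi \o h =1 g] -> psi =1 phi.

End Enveloping.

(* Main.v *)
Require Import Defs.
From HB Require Import structures.
From mathcomp Require Import all_boot all_order all_algebra.
From mathcomp Require Import boolp classical_sets.
From mathcomp Require Import ring.
Set Implicit Arguments.
Unset Strict Implicit.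
Unset Printing Implicit Defensive.
Import GRing.Theory.
Local Open Scope ring_scope.

(** The idea is to obtain both maps from the universal property of the
    enveloping algebra, and to check the axioms by its uniqueness part.

    The comultiplication.  Put [M := m ⊗ m] and [G := m ⊗ h + h ⊗ m], two maps
    from A ⊗ A to Ae ⊗ Ae.  With the bracket [tpbr] of A ⊗ A they satisfy
    all the identities required of an enveloping pair: [tens_env_pbr],
    [tens_env_lie] and [tens_env_mul].  On pure tensors these come down to the
    defining identities of (m, h) in both factors, together with
    [env_pbr_antiE]: by antisymmetry of the bracket, m({a,b}) is also equal to
    m(a) h(b) - (-1)^(|a||b|) h(b) m(a), and this is what makes the mixed terms
    cancel.  As [Delta] respects products, brackets and differentials, the pair
    (M Delta, G Delta) is an enveloping pair from A to Ae ⊗ Ae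
    ([Delta_enveloping_pair]); it induces the comultiplication.

    The counit.  It is induced by the pair (eps, 0) with values in the ground
    field.  The only point is that eps kills brackets ([counit_pbr]): applying
    eps ⊗ eps to Delta{a,b} = {Delta a, Delta b} gives
    eps{a,b} = eps{a,b} + eps{a,b}.

    The axioms.  Both maps are DG algebra maps by construction.  Each side of
    coassociativity and of the counit laws is a composite of DG algebra maps
    out of Ae, and two such maps are equal as soon as they agree after m and
    after h ([enveloping_ext]); there the laws reduce to those of A
    ([coassoc_generators], [counitl_generators], [counitr_generators]).  The
    coderivation law only restates compatibility with the differential of
    Ae ⊗ Ae ([tdiff_twist]).

    All this requires tensor products of DG algebras to be DG algebras, in
    particular to be nonzero rings: 1 ⊗ 1 is detected by linear functionals,
    which exist by Zorn's lemma ([exists_functional]). *)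

Arguments homogM {k s i j a b} : rename.
Arguments diff_homog {k s i a} : rename.
Arguments diffM {k s i a} b : rename.
Arguments pbr_anti {k s i j a b} : rename.
Arguments graded_mulC {k s i j a b} : rename.

(** * Nonzero pure tensors *)

Section NonzeroTensors.
Variables (k : fieldType).

(** A subspace [W] maximal among those that avoid [v] is a hyperplane: every [x]
    has a unique [c] such that [x - c *: v] lies in [W], and [c] is the value of
    the functional. *)
Lemma exists_functional (V : lmodType k) (v : V) : v != 0 ->
  exists phi : {linear V -> k^o}, phi v = 1.
Proof.
move=> v0.
pose P (W : set V) := (forall c x y, W x -> W y -> W (c *: x + y)) /\ ~ W v.
have [W [[WP Wv] Wmax]] : exists W, P W /\ forall B, (W `<` B)%classic -> ~ P B.
  apply: Zorn_bigcup => F FP Ftot; split=> [c x y|[X FX Xv]]; last first.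
    exact: (FP _ FX).2.
  move=> [X FX Xx] [Y FY Yy].
  have [XY|YX] := Ftot X Y FX FY.
    by exists Y => //; apply: (FP _ FY).1 => //; apply: XY.
  by exists X => //; apply: (FP _ FX).1 => //; apply: YX.
(* [P] admits the empty set, the union of the empty chain; a maximal [W] is
   nonempty because it could be enlarged to the zero subspace. *)
have W0 : W 0.
  apply: contrapT => nW0; have Wempty x : ~ W x.
    by move=> Wx; apply: nW0; rewrite -(addNr x) -scaleN1r; apply: WP.
  apply: (Wmax [set 0]%classic).
    by split=> [x /Wempty //|] /(_ 0 erefl) /Wempty.
  split=> [c x y -> ->|/eqP]; last exact/negP.
  by rewrite scaler0 addr0.
have span x : exists c, W (x - c *: v).
  have [Wx|nWx] := pselect (W x); first by exists 0; rewrite scale0r subr0.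
  pose B : set V := [set z | exists c y, W y /\ z = c *: x + y]%classic.
  have : B v.
    apply: contrapT => nBv; apply: (Wmax B); last split=> //.
      split=> [y Wy|BW]; first by exists 0, y; rewrite scale0r add0r.
      by apply: nWx; apply: BW; exists 1, 0; rewrite scale1r addr0.
    move=> c y z [a [y' [Wy ->]]] [b [z' [Wz ->]]].
    exists (c * a + b), (c *: y' + z'); split; first exact: WP.
    by rewrite scalerDr scalerA addrACA -scalerDl.
  move=> [c [y [Wy vE]]]; have c0 : c != 0.
    apply/eqP => c0; apply: Wv.
    by rewrite vE c0 scale0r add0r.
  exists c^-1; rewrite vE scalerDr scalerA mulVf // scale1r opprD addrA subrr.
  by rewrite add0r -scaleNr -[_ *: _]addr0; apply: WP.
have uniq c c' x : W (x - c *: v) -> W (x - c' *: v) -> c = c'.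
  move=> Wc Wc'; apply: contrapT => /eqP; rewrite -subr_eq0 => cc'.
  apply: Wv; have := WP (-1) _ _ Wc Wc'.
  rewrite scaleN1r opprB addrA subrK -scalerBl => Wd.
  have := WP (c - c')^-1 _ _ Wd W0.
  by rewrite scalerA mulVf // scale1r addr0.
pose phi x : k^o := sval (cid (span x)).
have phiE x : W (x - phi x *: v) by exact: (svalP (cid (span x))).
have phi_lin : linear phi.
  move=> c x y; apply: (uniq _ _ (c *: x + y) (phiE _)).
  have := WP c _ _ (phiE x) (phiE y); congr W.
  by rewrite scalerBr scalerA addrACA -opprD -scalerDl.
pose phiL : {linear V -> k^o} := HB.pack phi
  (GRing.isLinear.Build _ _ _ _ phi phi_lin).
exists phiL => /=.
by apply: (uniq _ _ v (phiE v)); rewrite scale1r subrr.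
Qed.

Lemma tpure_neq0 (U V : lmodType k) (u : U) (v : V) :
  u != 0 -> v != 0 -> u ⊗ v != 0.
Proof.
move=> /exists_functional[phi phi1] /exists_functional[psi psi1].
have B : bilinear_for *:%R *:%R (fun u v => phi u * psi v : k^o).
  split=> [y c x x'|x c y y'] /=; rewrite linearP /= ?mulrDl ?mulrDr.
    by rewrite scalerAl.
  by rewrite scalerAr.
apply/eqP => uv0; have := tlift_pure u v B.
by rewrite uv0 (linear_eq0 (tlift_linear B)) phi1 psi1 mulr1 => /eqP;
  rewrite eq_sym oner_eq0.
Qed.
End NonzeroTensors.
(** * Signs and homogeneous elements *)

Section KoszulSigns.
Variable k : fieldType.
Implicit Types i j l : int.

Lemma signD i j : (-1) ^ (i + j) = (-1) ^ i * (-1) ^ j :> k.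
Proof. by rewrite expfzDr // oppr_eq0 oner_eq0. Qed.

Lemma sign_or i : (-1) ^ i = 1 :> k \/ (-1) ^ i = -1 :> k.
Proof.
have /eqP : (-1) ^ i * (-1) ^ i = 1 :> k.
  by rewrite -expfzMl mulrNN mulr1 exp1rz.
by rewrite -expr2 sqrf_eq1 => /orP[] /eqP ->; [left | right].
Qed.

Lemma signMM i : (-1) ^ i * (-1) ^ i = 1 :> k.
Proof. by case: (sign_or i) => ->; rewrite ?mulrNN mulr1. Qed.

Lemma signS i : (-1) ^ (i + 1) = - (-1) ^ i :> k.
Proof. by rewrite signD expr1z mulrN1. Qed.

End KoszulSigns.

Section TensorInduction.
Variables (k : fieldType) (U V : grModType k).

Lemma tpure0l (X Y : lmodType k) (y : Y) : 0 ⊗ y = 0 :> (X ⊗ Y)%type.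
Proof. by rewrite -(scale0r (0 : X)) tpureZl scale0r. Qed.

Lemma tpure0r (X Y : lmodType k) (x : X) : x ⊗ 0 = 0 :> (X ⊗ Y)%type.
Proof. by rewrite -(scale0r (0 : Y)) tpureZr scale0r. Qed.

Lemma homog0 (W : grModType k) n : homog n (0 : W).
Proof. exact: linear0. Qed.

Lemma homogD (W : grModType k) n (x y : W) :
  homog n x -> homog n y -> homog n (x + y).
Proof. by rewrite /homog linearD /= => -> ->. Qed.

Lemma homogZ (W : grModType k) n c (x : W) : homog n x -> homog n (c *: x).
Proof. by rewrite /homog linearZ /= => ->. Qed.

Lemma homog_tpure i j (u : U) (v : V) :
  homog i u -> homog j v -> homog (i + j) (u ⊗ v).
Proof. by move=> ui vj; have := tens_gpart_homog (i + j) ui vj; rewrite eqxx. Qed.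

(** A homogeneous tensor is fixed by the projection to its degree, and
    that projection kills the pure tensors of the other degrees. *)
Lemma homog_tens_ind n (P : U ⊗ V -> Prop) :
    P 0 -> (forall s t, P s -> P t -> P (s + t)) ->
    (forall i j u v, homog i u -> homog j v -> i + j = n -> P (u ⊗ v)) ->
  forall t, homog n t -> P t.
Proof.
move=> P0 PD Ph t <-; elim/tens_homog_ind: t => [|s t|i j u v ui vj].
- by rewrite linear0.
- by rewrite linearD; apply: PD.
have -> : gpart n (u ⊗ v) = if n == i + j then u ⊗ v else 0.
  exact: tens_gpart_homog.
by case: eqP => // nE; apply: (Ph i j).
Qed.

Lemma tens_ext (W : lmodType k) (f g : U ⊗ V -> W) : linear f -> linear g ->
  (forall i j u v, homog i u -> homog j v -> f (u ⊗ v) = g (u ⊗ v)) -> f =1 g.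
Proof.
move=> fl gl fg t; elim/tens_homog_ind: t => [|s t sE tE|i j u v].
- by rewrite !linear_eq0.
- by have := (fl 1 s t, gl 1 s t); rewrite !scale1r sE tE => -[-> ->].
exact: fg.
Qed.

Lemma homog_ind (W : grModType k) (P : W -> Prop) :
    (forall s t, P s -> P t -> P (s + t)) ->
  (forall i x, homog i x -> P x) -> forall x, P x.
Proof.
move=> PD Ph x; have [r ur rx] := gpart_supp x.
have xE := gsumE (F := fun _ => id) (fun _ _ _ _ => erefl) ur rx.
rewrite gpart_sum in xE; rewrite xE; apply: big_ind => //.
  exact: (Ph 0 0 (homog0 _ _)).
by move=> i _; apply: (Ph i); rewrite /homog gpartK eqxx.
Qed.

End TensorInduction.

(** * The tensor product of graded and DG algebras *)

Section TensorAlgebraInstance.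
Variables (k : fieldType) (A B : grAlgType k).
Implicit Types x y z : (A ⊗ B)%type.

Let tmul_bilinear : bilinear_for *:%R *:%R (@tmul k A B).
Proof. exact: klift_bilinear (@tmul_multilinear k A B). Qed.

Lemma tmulDl : left_distributive (@tmul k A B) +%R.
Proof. by move=> x y z; have := tmul_bilinear.1 z 1 x y; rewrite /= !scale1r. Qed.

Lemma tmulDr : right_distributive (@tmul k A B) +%R.
Proof. by move=> z x y; have := tmul_bilinear.2 z 1 x y; rewrite /= !scale1r. Qed.

Lemma tmul0l x : tmul 0 x = 0.
Proof. exact: (linear_eq0 (tmul_bilinear.1 x)). Qed.

Lemma tmul0r x : tmul x 0 = 0.
Proof. exact: (linear_eq0 (tmul_bilinear.2 x)). Qed.

Lemma tmulZl c x y : c *: tmul x y = tmul (c *: x) y.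
Proof.
by have := tmul_bilinear.1 y c x 0; rewrite /= tmul0l !addr0 => <-.
Qed.

Lemma tmulZr c x y : c *: tmul x y = tmul x (c *: y).
Proof.
by have := tmul_bilinear.2 x c y 0; rewrite /= tmul0r !addr0 => <-.
Qed.

Lemma tmul1l : left_id (1 ⊗ 1) (@tmul k A B).
Proof.
apply: tens_ext => [|//|i j a b ai bj]; first exact: tmul_bilinear.2.
by rewrite (tmul_homog _ _ (homog1 : homog 0 (1 : B)) ai) mul0r scale1r !mul1r.
Qed.

Lemma tmul1r : right_id (1 ⊗ 1) (@tmul k A B).
Proof.
move=> x; elim/tens_homog_ind: x => [|s t sE tE|i j a b ai bj].
- exact: tmul0l.
- by rewrite tmulDl sE tE.
by rewrite (tmul_homog _ _ bj (homog1 : homog 0 (1 : A))) mulr0 scale1r !mulr1.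
Qed.

Lemma tmulA : associative (@tmul k A B).
Proof.
elim/tens_homog_ind=> [|s t sE tE|i1 j1 a1 b1 ai1 bj1] y z.
- by rewrite !tmul0l.
- by rewrite !tmulDl sE tE.
elim/tens_homog_ind: y => [|s t sE tE|i2 j2 a2 b2 ai2 bj2].
- by rewrite !(tmul0l, tmul0r).
- by rewrite !(tmulDl, tmulDr) sE tE.
elim/tens_homog_ind: z => [|s t sE tE|i3 j3 a3 b3 ai3 bj3].
- by rewrite !tmul0r.
- by rewrite !tmulDr sE tE.
rewrite (tmul_homog _ _ bj2 ai3) (tmul_homog _ _ bj1 ai2) -tmulZl -tmulZr.
rewrite (tmul_homog _ _ bj1 (homogM ai2 ai3)).
rewrite (tmul_homog _ _ (homogM bj1 bj2) ai3) !mulrA !scalerA.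
rewrite mulrDl mulrDr !signD; congr (_ *: _).
ring.
Qed.

Lemma tone_neq0 : 1 ⊗ 1 != 0 :> (A ⊗ B)%type.
Proof. by apply: tpure_neq0; exact: oner_neq0. Qed.

HB.instance Definition _ := GRing.Zmodule_isNzRing.Build (A ⊗ B)%type
  tmulA tmul1l tmul1r tmulDl tmulDr tone_neq0.
HB.instance Definition _ := GRing.Lmodule_isLalgebra.Build k (A ⊗ B)%type tmulZl.
HB.instance Definition _ := GRing.Lalgebra_isAlgebra.Build k (A ⊗ B)%type tmulZr.

Lemma tens_homog1 : homog 0 (1 : (A ⊗ B)%type).
Proof. by rewrite -[0]addr0; apply: homog_tpure; exact: homog1. Qed.

Lemma tpureM i j (a a' : A) (b b' : B) : homog i b -> homog j a' ->
  (a ⊗ b) * (a' ⊗ b') = (-1) ^ (i * j) *: ((a * a') ⊗ (b * b')).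
Proof. exact: tmul_homog. Qed.

Lemma tens_homogM i j x y : homog i x -> homog j y -> homog (i + j) (x * y).
Proof.
move=> xi yj; move: x xi; apply: homog_tens_ind => [|s t si ti|i1 i2 a b ai bi ii].
- by rewrite mul0r; exact: homog0.
- by rewrite mulrDl; exact: homogD.
move: y yj; apply: homog_tens_ind => [|s t si ti|j1 j2 a' b' aj bj jj].
- by rewrite mulr0; exact: homog0.
- by rewrite mulrDr; exact: homogD.
rewrite (tpureM _ _ bi aj) -ii -jj addrACA; apply/homogZ/homog_tpure;
  exact: homogM.
Qed.

HB.instance Definition _ := isGradedAlgebra.Build k (A ⊗ B)%type
  tens_homog1 tens_homogM.

End TensorAlgebraInstance.
Section TensorDGInstance.
Variables (k : fieldType) (A B : dgAlgType k).
Implicit Types x y : (A ⊗ B)%type.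

Lemma tdiff_linear : linear (@tdiff k A B).
Proof.
apply: tlift_linear; split=> [b c a a'|a c b b'] /=.
  by rewrite linearP gsign_linear !tpureDl !tpureZl scalerDr addrACA.
by rewrite linearP !tpureDr !tpureZr scalerDr addrACA.
Qed.

HB.instance Definition _ := GRing.isLinear.Build k (A ⊗ B)%type (A ⊗ B)%type _
  (@tdiff k A B) tdiff_linear.

Lemma tdiff0 : tdiff (0 : A ⊗ B) = 0. Proof. exact: linear0. Qed.

Lemma tdiffD x y : tdiff (x + y) = tdiff x + tdiff y. Proof. exact: linearD. Qed.

Lemma tdiffZ c x : tdiff (c *: x) = c *: tdiff x. Proof. exact: linearZ. Qed.

Lemma tdiff_degree i x : homog i x -> homog (i + 1) (tdiff x).
Proof.
move: x; apply: homog_tens_ind => [|s t si ti|i1 i2 a b ai bi <-].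
- by rewrite tdiff0; exact: homog0.
- by rewrite tdiffD; exact: homogD.
rewrite (tdiff_homog _ ai); apply: homogD.
  by rewrite addrAC; apply: homog_tpure => //; exact: diff_homog.
by apply: homogZ; rewrite -addrA; apply: homog_tpure => //; exact: diff_homog.
Qed.

Lemma tdiff_tdiff x : tdiff (tdiff x) = 0.
Proof.
elim/tens_homog_ind: x => [|s t sE tE|i j a b ai bj].
- by rewrite !tdiff0.
- by rewrite !tdiffD sE tE addr0.
rewrite (tdiff_homog _ ai) tdiffD tdiffZ (tdiff_homog _ ai).
rewrite (tdiff_homog _ (diff_homog ai)) !diff_diff signS scalerDr scalerA.
by rewrite tpure0l tpure0r scaler0 addr0 add0r scaleNr addNr.
Qed.

Lemma tdiffM i x y : homog i x ->
  tdiff (x * y) = tdiff x * y + (-1) ^ i *: (x * tdiff y).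
Proof.
move: x; apply: homog_tens_ind => [|s t sE tE|i1 i2 a b ai bi <-].
- by rewrite tdiff0 !mul0r tdiff0 scaler0 addr0.
- by rewrite tdiffD !mulrDl tdiffD sE tE scalerDr addrACA.
elim/tens_homog_ind: y => [|s t sE tE|j1 j2 a' b' aj bj].
- by rewrite tdiff0 !mulr0 tdiff0 scaler0 addr0.
- by rewrite tdiffD !mulrDr tdiffD sE tE scalerDr addrACA.
rewrite (tpureM _ _ bi aj) tdiffZ (tdiff_homog _ (homogM ai aj)).
rewrite (diffM a' ai) (diffM b' bi) (tdiff_homog _ ai) (tdiff_homog _ aj).
rewrite mulrDl mulrDr -scalerAl -scalerAr.
rewrite (tpureM _ _ bi aj) (tpureM _ _ (diff_homog bi) aj).
rewrite (tpureM _ _ bi (diff_homog aj)) (tpureM _ _ bi aj).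
rewrite tpureDl tpureDr tpureZl tpureZr !scalerDr !scalerA.
rewrite !mulrDl !mulrDr !signD !mul1r !mulr1 [RHS]addrACA.
congr (_ + _ + (_ + _)); congr (_ *: _); first last.
- ring.
- ring.
by case: (sign_or k i2) => ->; ring.
Qed.

HB.instance Definition _ := isDGAlgebra.Build k (A ⊗ B)%type
  tdiff_degree tdiff_tdiff tdiffM.

Lemma tens_diffE x : diff x = tdiff x. Proof. by []. Qed.

End TensorDGInstance.

(** * The ground field as a DG algebra *)

Section FieldDGInstance.
Variable k : fieldType.

Lemma homog_fieldE n (c : k^o) : homog n c <-> n = 0 \/ c = 0.
Proof.
rewrite /homog /= /gpart /= /field_gpart; split=> [|[]->].
- by case: eqP => [|_]; [left | rewrite scale0r; right].
- by rewrite scale1r.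
- by rewrite scaler0.
Qed.

Lemma field_homog1 : homog 0 (1 : k^o).
Proof. by apply/homog_fieldE; left. Qed.

Lemma field_homogM i j (a b : k^o) :
  homog i a -> homog j b -> homog (i + j) (a * b).
Proof.
move=> /homog_fieldE ai /homog_fieldE bj; apply/homog_fieldE.
case: ai bj => [->|->] [->|->]; rewrite ?mul0r ?mulr0 ?addr0; by [left | right].
Qed.

HB.instance Definition _ := isGradedAlgebra.Build k k^o
  field_homog1 field_homogM.

Definition field_diff : {linear k^o -> k^o} := \0.

Lemma field_diff_homog i (a : k^o) : homog i a -> homog (i + 1) (field_diff a).
Proof. by move=> _; exact: homog0. Qed.

Lemma field_diff_diff (a : k^o) : field_diff (field_diff a) = 0.
Proof. by []. Qed.

Lemma field_diffM i (a b : k^o) : homog i a ->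
  field_diff (a * b) = field_diff a * b + (-1) ^ i *: (a * field_diff b).
Proof. by rewrite /= mul0r mulr0 scaler0 addr0. Qed.

HB.instance Definition _ := isDGAlgebra.Build k k^o
  field_diff_homog field_diff_diff field_diffM.

End FieldDGInstance.

(** * Maps between tensor products *)

Section TensorMapTheory.
Variable k : fieldType.

Lemma tmap_linear (U V U' V' : lmodType k) (f : U -> U') (g : V -> V') :
  linear f -> linear g -> linear (tmap f g).
Proof. by move=> fl gl; apply: tlift_linear; exact: tmap_bilinear. Qed.

HB.instance Definition _ (U V U' V' : lmodType k) (f : {linear U -> U'})
    (g : {linear V -> V'}) :=
  GRing.isLinear.Build k (U ⊗ V)%type (U' ⊗ V')%type _ (tmap f g)
    (tmap_linear (linearP f) (linearP g)).

Lemma tmapE (U V U' V' : lmodType k) (f : {linear U -> U'})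
    (g : {linear V -> V'}) u v : tmap f g (u ⊗ v) = f u ⊗ g v.
Proof. by rewrite tmap_pure //; exact: linearP. Qed.

Lemma tmap0 (U V U' V' : lmodType k) (f : {linear U -> U'})
  (g : {linear V -> V'}) : tmap f g 0 = 0.
Proof. exact: linear0. Qed.

Lemma tmapD (U V U' V' : lmodType k) (f : {linear U -> U'})
  (g : {linear V -> V'}) s t : tmap f g (s + t) = tmap f g s + tmap f g t.
Proof. exact: linearD. Qed.

Lemma tmapZ (U V U' V' : lmodType k) (f : {linear U -> U'})
  (g : {linear V -> V'}) c t : tmap f g (c *: t) = c *: tmap f g t.
Proof. exact: linearZ. Qed.

Lemma tassoc_linear (U V W : lmodType k) : linear (@tassoc k U V W).
Proof.
have B w' : bilinear_for *:%R *:%R (fun (u : U) (v : V) => u ⊗ (v ⊗ w' : V ⊗ W)).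
  by split=> [v' c x x'|x c y y'] /=;
    rewrite ?(tpureDl, tpureZl) ?(tpureDr, tpureZr).
apply: tlift_linear; split=> [w|x c y y'] /=; first exact: tlift_linear.
apply: (tlift_param (F := fun w u v => u ⊗ (v ⊗ w))) => // u v d z z'.
by rewrite !tpureDr !tpureZr.
Qed.

HB.instance Definition _ (U V W : lmodType k) :=
  GRing.isLinear.Build k (U ⊗ V ⊗ W)%type (U ⊗ (V ⊗ W))%type _
    (@tassoc k U V W) (@tassoc_linear U V W).

Lemma tassoc0 (U V W : lmodType k) : tassoc (0 : U ⊗ V ⊗ W) = 0.
Proof. exact: linear0. Qed.

Lemma tassocD (U V W : lmodType k) (s t : (U ⊗ V ⊗ W)%type) :
  tassoc (s + t) = tassoc s + tassoc t.
Proof. exact: linearD. Qed.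

Lemma tassocZ (U V W : lmodType k) c (t : (U ⊗ V ⊗ W)%type) :
  tassoc (c *: t) = c *: tassoc t.
Proof. exact: linearZ. Qed.

Lemma tens_span_ind (U V : lmodType k) (P : U ⊗ V -> Prop) : P 0 ->
    (forall s t, P s -> P t -> P (s + t)) -> (forall u v, P (u ⊗ v)) ->
  forall t, P t.
Proof. by move=> P0 PD Pp t; have [s ->] := tens_sum t; apply: big_ind. Qed.

End TensorMapTheory.
Section DGMaps.
Variable k : fieldType.

Lemma dg_map_comp (A B C : dgAlgType k) (g : B -> C) (f : A -> B) :
  dg_map g -> dg_map f -> dg_map (g \o f).
Proof.
move=> [g0 gd] [f0 fd]; split=> [n a /f0 /g0 //|a].
by rewrite /= fd gd.
Qed.

Definition lrmorphism_of (A B : dgAlgType k) (f : {linear A -> B})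
    (f_mul : monoid_morphism f) : {lrmorphism A -> B} :=
  HB.pack (GRing.Linear.sort f) (GRing.isLinear.Build k A B _ f (linearP f))
    (GRing.isMonoidMorphism.Build A B f f_mul).

Variables A B A' B' : dgAlgType k.

Lemma tmap_degree0 (f : {linear A -> A'}) (g : {linear B -> B'}) :
  degree0 f -> degree0 g -> degree0 (tmap f g).
Proof.
move=> f0 g0 n; apply: homog_tens_ind => [|s t si ti|i j a b ai bj <-].
- by rewrite tmap0; exact: homog0.
- by rewrite tmapD; exact: homogD.
by rewrite tmapE; apply: homog_tpure; [exact: f0 | exact: g0].
Qed.

Lemma tmap_dg (f : {linear A -> A'}) (g : {linear B -> B'}) :
  dg_map f -> dg_map g -> dg_map (tmap f g).
Proof.
move=> [f0 fd] [g0 gd]; split; first exact: tmap_degree0.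
move=> x; rewrite !tens_diffE; elim/tens_homog_ind: x => [|s t sE tE|i j a b ai bj].
- by rewrite (@tdiff0 _ A B) !tmap0 (@tdiff0 _ A' B').
- by rewrite (@tdiffD _ A B) !tmapD (@tdiffD _ A' B') sE tE.
rewrite (tdiff_homog _ ai) tmapD tmapZ !tmapE.
by rewrite (tdiff_homog _ (f0 _ _ ai)) fd gd.
Qed.

(** Degree 0 is needed because the sign in the product depends on the degrees
    of the inner factors. *)
Lemma tmap_monoid_morphism (f : {lrmorphism A -> A'}) (g : {lrmorphism B -> B'}) :
  degree0 f -> degree0 g -> monoid_morphism (tmap f g).
Proof.
move=> f0 g0; split=> [|x y]; first by rewrite tmapE !rmorph1.
elim/tens_homog_ind: x => [|s t sE tE|i j a b ai bj].
- by rewrite mul0r tmap0 mul0r.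
- by rewrite mulrDl !tmapD sE tE mulrDl.
elim/tens_homog_ind: y => [|s t sE tE|i' j' a' b' ai' bj'].
- by rewrite mulr0 tmap0 mulr0.
- by rewrite mulrDr !tmapD sE tE mulrDr.
rewrite (tpureM _ _ bj ai') tmapZ !tmapE !rmorphM.
by rewrite (tpureM _ _ (g0 _ _ bj) (f0 _ _ ai')).
Qed.

End DGMaps.

Section TensorAssociativity.
Variables (k : fieldType) (A B C : dgAlgType k).
Implicit Types x y : (A ⊗ B ⊗ C)%type.

Lemma homog_tens3_ind n (P : A ⊗ B ⊗ C -> Prop) : P 0 ->
    (forall s t, P s -> P t -> P (s + t)) ->
    (forall i j l a b c, homog i a -> homog j b -> homog l c -> i + j + l = n ->
      P (a ⊗ b ⊗ c)) ->
  forall x, homog n x -> P x.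
Proof.
move=> P0 PD Pp; apply: homog_tens_ind => // r l t c tr cl rl.
move: t tr; apply: homog_tens_ind => [|s t Ps Pt|i j a b ai bj ij].
- by rewrite tpure0l.
- by rewrite tpureDl; exact: PD.
by apply: (Pp i j l) => //; rewrite ij.
Qed.

Lemma tens3_homog_ind (P : A ⊗ B ⊗ C -> Prop) : P 0 ->
    (forall s t, P s -> P t -> P (s + t)) ->
    (forall i j l a b c, homog i a -> homog j b -> homog l c -> P (a ⊗ b ⊗ c)) ->
  forall x, P x.
Proof.
move=> P0 PD Pp; apply: homog_ind => // n x; apply: homog_tens3_ind => //.
by move=> i j l a b c ai bj cl _; apply: (Pp i j l).
Qed.

Lemma tassoc_dg : dg_map (@tassoc k A B C).
Proof.
split=> [n|].
  apply: homog_tens3_ind => [|s t si ti|i j l a b c ai bj cl <-].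
  - by rewrite tassoc0; exact: homog0.
  - by rewrite tassocD; exact: homogD.
  by rewrite tassoc_pure -addrA; do 2!apply: homog_tpure => //.
apply: tens3_homog_ind => [|s t sE tE|i j l a b c ai bj cl].
- by rewrite tens_diffE tdiff0 !tassoc0 tens_diffE tdiff0.
- by rewrite !tens_diffE tdiffD !tassocD tdiffD -!tens_diffE sE tE.
rewrite tassoc_pure !tens_diffE (tdiff_homog _ (homog_tpure ai bj)) tens_diffE.
rewrite (tdiff_homog _ ai) (tdiff_homog _ ai) tens_diffE (tdiff_homog _ bj).
rewrite tpureDl tpureZl tpureDr tpureZr !tassocD !tassocZ !tassoc_pure.
by rewrite signD scalerDr scalerA addrA.
Qed.

Lemma tassoc_monoid_morphism : monoid_morphism (@tassoc k A B C).
Proof.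
split=> [|x y]; first exact: tassoc_pure.
elim/tens3_homog_ind: x => [|s t sE tE|i j l a b c ai bj cl].
- by rewrite mul0r tassoc0 mul0r.
- by rewrite mulrDl !tassocD sE tE mulrDl.
elim/tens3_homog_ind: y => [|s t sE tE|i' j' l' a' b' c' ai' bj' cl'].
- by rewrite mulr0 tassoc0 mulr0.
- by rewrite mulrDr !tassocD sE tE mulrDr.
rewrite !tassoc_pure (tpureM _ _ cl (homog_tpure ai' bj')) (tpureM _ _ bj ai').
rewrite (tpureM _ _ (homog_tpure bj cl) ai') (tpureM _ _ cl bj').
rewrite tpureZl tpureZr !tassocZ tassoc_pure !scalerA; congr (_ *: _).
by rewrite !(mulrDl, mulrDr) !signD; ring.
Qed.

End TensorAssociativity.
(** * The tensor square of an enveloping pair *)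

Lemma eq_of_sub0 (V : zmodType) (x y : V) : 0 + x - y = 0 -> x = y.
Proof. by rewrite add0r => /eqP; rewrite subr_eq0 => /eqP. Qed.

(** Proves that two sums with the same terms in different orders agree: each term is
    moved next to its opposite. *)
Ltac cancel_last :=
  lazymatch goal with
  | |- ?S + ?u - ?u = 0 => rewrite (addrK u S)
  | |- ?S - ?u + ?u = 0 => rewrite (subrK u S)
  | |- ?S - ?u = 0 => rewrite (addrAC _ u); cancel_last
  | |- ?S + ?u = 0 => rewrite (addrAC _ (- u)); cancel_last
  end.
Ltac zmod_cancel :=
  apply: eq_of_sub0; rewrite ?(opprD, opprK, addrA); repeat cancel_last; by [].

(** The identities of this section are those of an enveloping pair on two pure
    tensors a ⊗ a' and b ⊗ b', after expansion of all products.  They are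
    stated for a bilinear map in place of the tensor product and with atoms in
    place of the monomials:
    [P = m{a,b}], [L = h{a,b}], [X = m(b) h(a)], [Y = h(b) m(a)],
    [Z = m(b) m(a)], [T = h(b) h(a)] and [H = m(a) h(b)]; a prime marks the
    same monomial in a' and b'.  The scalars are Koszul signs:
    [p = (-1)^(|a||b|)], [r = (-1)^(|a'||b'|)], [q = (-1)^(|a'||b|)],
    [t = (-1)^(|b'||a|)], and [s] is the sign of exchanging the two
    tensors. *)
Section BilinearIdentities.
Variables (k : fieldType) (U W V : lmodType k) (f : U -> W -> V).
Hypothesis f_bilinear : bilinear_for *:%R *:%R f.

Let fDl u u' w : f (u + u') w = f u w + f u' w.
Proof. by have := f_bilinear.1 w 1 u u'; rewrite /= !scale1r. Qed.
Let fDr u w w' : f u (w + w') = f u w + f u w'.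
Proof. by have := f_bilinear.2 u 1 w w'; rewrite /= !scale1r. Qed.
Let fZl c u w : f (c *: u) w = c *: f u w.
Proof.
have f0 := linear_eq0 (f_bilinear.1 w).
by have := f_bilinear.1 w c u 0; rewrite /= f0 !addr0.
Qed.
Let fZr c u w : f u (c *: w) = c *: f u w.
Proof.
have f0 := linear_eq0 (f_bilinear.2 u).
by have := f_bilinear.2 u c w 0; rewrite /= f0 !addr0.
Qed.

Variables (p r q s t : k).
Hypothesis st : s * t = q * (p * r).
Variables (P L X Y Z T H : U) (P' L' X' Y' Z' T' H' : W).

Ltac expand :=
  rewrite -!(scalerDr t) scalerA st -(scalerA q) -!scalerDr -?scalerBr;
  congr (_ *: _); rewrite !(fDl, fDr, fZl, fZr) !(scalerDr, scalerA).
Ltac atoms := repeat match goal with |- context [f ?u ?v] =>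
  let x := fresh "x" in set x := f u v; clearbody x end.

Lemma bilinear_pbr_identity :
  q *: (f P (r *: Z') + f (p *: Z) P') =
  q *: f (p *: Z) (P' + r *: X') + q *: f (P + p *: X) (r *: Z')
  - s *: (t *: f Z X' + t *: f X Z').
Proof.
expand; atoms; rewrite ?(mulrC r p); zmod_cancel.
Qed.

Lemma bilinear_mul_identity :
  q *: (f (p *: Z) (H' + r *: X') + f (H + p *: X) (r *: Z')) =
  q *: f (p *: Z) H' + q *: f H (r *: Z')
  + s *: (t *: f Z X' + t *: f X Z').
Proof.
expand; atoms; rewrite ?(mulrC r p); zmod_cancel.
Qed.

Lemma bilinear_lie_identity :
  q *: (f P (P' + r *: Y' + r *: X') + f L (r *: Z')
        + (f (p *: Z) L' + f (P + p *: Y + p *: X) P')) =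
  q *: f (p *: Z) (L' + r *: T') + q *: f (P + p *: Y) (P' + r *: X')
  + (q *: f (P + p *: X) (P' + r *: Y') + q *: f (L + p *: T) (r *: Z'))
  - s *: (t *: f Z T' + t *: f X Y' + (t *: f Y X' + t *: f T Z')).
Proof.
expand; atoms; rewrite ?(mulrC r p); zmod_cancel.
Qed.

End BilinearIdentities.

Section TensorInduction2.
Variables (k : fieldType) (U V U' V' : grModType k).

Lemma homog_tens_ind2 n n' (P : (U ⊗ V)%type -> (U' ⊗ V')%type -> Prop) :
    (forall y, P 0 y) -> (forall x, P x 0) ->
    (forall s t y, P s y -> P t y -> P (s + t) y) ->
    (forall x s t, P x s -> P x t -> P x (s + t)) ->
    (forall i i' j j' u v u' v', homog i u -> homog i' v -> homog j u' ->
      homog j' v' -> i + i' = n -> j + j' = n' -> P (u ⊗ v) (u' ⊗ v')) ->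
  forall x y, homog n x -> homog n' y -> P x y.
Proof.
move=> P0l P0r PDl PDr Pp x y xn yn; move: x xn.
apply: homog_tens_ind => [|s t|i i' u v ui vi ii]; [exact: P0l|exact: PDl|].
move: y yn; apply: homog_tens_ind => [|s t|j j' u' v' uj vj jj];
  [exact: P0r|exact: PDr|exact: (Pp i i' j j')].
Qed.

End TensorInduction2.

Section TensorBracket.
Variables (k : fieldType) (A B : dgPoissonType k).
Implicit Types x y : (A ⊗ B)%type.

Let tpbr_bilinear : bilinear_for *:%R *:%R (@tpbr k A B).
Proof. exact: klift_bilinear (@tpbr_multilinear k A B). Qed.

Lemma tpbr0l y : tpbr 0 y = 0.
Proof. exact: (linear_eq0 (tpbr_bilinear.1 y)). Qed.

Lemma tpbr0r x : tpbr x 0 = 0.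
Proof. exact: (linear_eq0 (tpbr_bilinear.2 x)). Qed.

Lemma tpbrDl x x' y : tpbr (x + x') y = tpbr x y + tpbr x' y.
Proof. by have := tpbr_bilinear.1 y 1 x x'; rewrite /= !scale1r. Qed.

Lemma tpbrDr x y y' : tpbr x (y + y') = tpbr x y + tpbr x y'.
Proof. by have := tpbr_bilinear.2 x 1 y y'; rewrite /= !scale1r. Qed.

End TensorBracket.

Section EnvelopingPairs.
Variables (k : fieldType) (A : dgPoissonType k) (D : dgAlgType k).
Variables (m : {lrmorphism A -> D}) (h : {linear A -> D}).
Hypothesis mh : enveloping_pair m h.
Variables (i j : int) (a b : A).
Hypotheses (ai : homog i a) (bj : homog j b).
Let p : k := (-1) ^ (i * j).

Lemma env_pbrE : h a * m b = m (pbr a b) + p *: (m b * h a).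
Proof. by rewrite (env_pbr mh ai bj) subrK. Qed.

(** The identity for m({b,a}), read through antisymmetry: in m({a,b}) the roles
    of m and h can be exchanged. *)
Lemma env_pbr_antiE : m a * h b = m (pbr a b) + p *: (h b * m a).
Proof.
rewrite (pbr_anti ai bj) linearN linearZ /= (env_pbr mh bj ai) scalerBr scalerA.
by rewrite [j * i]mulrC -/p signMM scale1r opprB subrK.
Qed.

Lemma env_lieE : h a * h b = h (pbr a b) + p *: (h b * h a).
Proof. by rewrite (env_lie mh ai bj) subrK. Qed.

Lemma env_mulC : m a * m b = p *: (m b * m a).
Proof. by rewrite -!rmorphM -linearZ /= -(graded_mulC ai bj). Qed.

End EnvelopingPairs.

(** Exchanging a ⊗ a' and b ⊗ b' before multiplying costs, besides the sign of
    the product in the original order, one sign for each factor. *)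
Lemma sign_swap (k : fieldType) (i i' j j' : int) :
  (-1) ^ ((i + i') * (j + j')) * (-1) ^ (j' * i) =
  (-1) ^ (i' * j) * ((-1) ^ (i * j) * (-1) ^ (i' * j')) :> k.
Proof.
rewrite !(mulrDl, mulrDr) !signD [j' * i]mulrC.
by case: (sign_or k (i * j')) => ->; ring.
Qed.

Section TensorEnvelopingPair.
Variables (k : fieldType) (A : dgPoissonType k) (D : dgAlgType k).
Variables (m : {lrmorphism A -> D}) (h : {linear A -> D}).
Hypothesis mh : enveloping_pair m h.

Let M : (A ⊗ A)%type -> (D ⊗ D)%type := tmap m m.
(** The h-component of the enveloping pair from A ⊗ A to D ⊗ D whose
    m-component is [tmap m m]. *)
Definition tens_env_h (x : (A ⊗ A)%type) : (D ⊗ D)%type := tmap m h x + tmap h m x.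
Let G := tens_env_h.

Let mM a b : m (a * b) = m a * m b. Proof. exact: rmorphM. Qed.
Let ME a b : M (a ⊗ b) = m a ⊗ m b. Proof. by rewrite /M tmapE. Qed.
Let MZ c x : M (c *: x) = c *: M x. Proof. exact: tmapZ. Qed.
Let M0 : M 0 = 0. Proof. exact: tmap0. Qed.
Let MD x y : M (x + y) = M x + M y. Proof. exact: tmapD. Qed.
Let G0 : G 0 = 0. Proof. by rewrite /G /tens_env_h !tmap0 addr0. Qed.
Let GD x y : G (x + y) = G x + G y.
Proof. by rewrite /G /tens_env_h !tmapD addrACA. Qed.
Let GZ c x : G (c *: x) = c *: G x.
Proof. by rewrite /G /tens_env_h !tmapZ scalerDr. Qed.
Let GE a b : G (a ⊗ b) = m a ⊗ h b + h a ⊗ m b.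
Proof. by rewrite /G /tens_env_h !tmapE. Qed.

Let m0 := (env_dg_f mh).1.
Let h0 := (env_dg_g mh).1.

Lemma tens_env_pbr n n' x y : homog n x -> homog n' y ->
  M (tpbr x y) = G x * M y - (-1) ^ (n * n') *: (M y * G x).
Proof.
move: x y; apply: homog_tens_ind2 => [y|x|s t y sE tE|x s t sE tE|].
- by rewrite tpbr0l M0 G0 mul0r mulr0 scaler0 subr0.
- by rewrite tpbr0r M0 mul0r mulr0 scaler0 subr0.
- rewrite tpbrDl MD GD sE tE (mulrDl (G s)) (mulrDr _ (G s)) scalerDr opprD.
  exact: addrACA.
- rewrite tpbrDr !MD sE tE (mulrDr _ (M s)) (mulrDl (M s)) scalerDr opprD.
  exact: addrACA.
move=> i i' j j' a a' b b' ai ai' bj bj' <- <-.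
rewrite (tpbr_homog _ _ ai' bj) MZ MD !ME !GE !mM.
rewrite (mulrDl (m a ⊗ h a')) (mulrDr (m b ⊗ m b')).
rewrite (tpureM _ _ (h0 ai') (m0 bj)) (tpureM _ _ (m0 ai') (m0 bj)).
rewrite (tpureM _ _ (m0 bj') (m0 ai)) (tpureM _ _ (m0 bj') (h0 ai)).
rewrite (env_pbrE mh ai bj) (env_pbrE mh ai' bj').
rewrite (env_mulC m ai bj) (env_mulC m ai' bj').
exact: (bilinear_pbr_identity (@tpure_bilinear k D D) (sign_swap k i i' j j')).
Qed.

Lemma tens_env_mul n n' x y : homog n x -> homog n' y ->
  G (x * y) = M x * G y + (-1) ^ (n * n') *: (M y * G x).
Proof.
move: x y; apply: homog_tens_ind2 => [y|x|s t y sE tE|x s t sE tE|].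
- by rewrite mul0r M0 G0 mul0r mulr0 scaler0 addr0.
- by rewrite mulr0 M0 G0 mulr0 mul0r scaler0 addr0.
- rewrite mulrDl MD !GD sE tE (mulrDl (M s)) (mulrDr _ (G s)) scalerDr.
  exact: addrACA.
- rewrite mulrDr !MD !GD sE tE (mulrDr _ (G s)) (mulrDl (M s)) scalerDr.
  exact: addrACA.
move=> i i' j j' a a' b b' ai ai' bj bj' <- <-.
rewrite (tpureM _ _ ai' bj) GZ !ME !GE !mM.
rewrite (mulrDr (m a ⊗ m a')) (mulrDr (m b ⊗ m b')).
rewrite (tpureM _ _ (m0 ai') (m0 bj)) (tpureM _ _ (m0 ai') (h0 bj)).
rewrite (tpureM _ _ (m0 bj') (m0 ai)) (tpureM _ _ (m0 bj') (h0 ai)).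
rewrite (env_mul mh ai bj) (env_mul mh ai' bj').
rewrite (env_mulC m ai bj) (env_mulC m ai' bj').
exact: (bilinear_mul_identity (@tpure_bilinear k D D) (sign_swap k i i' j j')).
Qed.

Lemma tens_env_lie n n' x y : homog n x -> homog n' y ->
  G (tpbr x y) = G x * G y - (-1) ^ (n * n') *: (G y * G x).
Proof.
move: x y; apply: homog_tens_ind2 => [y|x|s t y sE tE|x s t sE tE|].
- by rewrite tpbr0l G0 mul0r mulr0 scaler0 subr0.
- by rewrite tpbr0r G0 mul0r mulr0 scaler0 subr0.
- rewrite tpbrDl !GD sE tE (mulrDl (G s)) (mulrDr _ (G s)) scalerDr opprD.
  exact: addrACA.
- rewrite tpbrDr !GD sE tE (mulrDr _ (G s)) (mulrDl (G s)) scalerDr opprD.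
  exact: addrACA.
move=> i i' j j' a a' b b' ai ai' bj bj' <- <-.
rewrite (tpbr_homog _ _ ai' bj) GZ GD !GE !mM.
rewrite (mulrDl (m a ⊗ h a')) 2!(mulrDr _ (m b ⊗ h b')).
rewrite (mulrDl (m b ⊗ h b')) 2!(mulrDr _ (m a ⊗ h a')).
rewrite (tpureM _ _ (h0 ai') (m0 bj)) (tpureM _ _ (h0 ai') (h0 bj)).
rewrite (tpureM _ _ (m0 ai') (m0 bj)) (tpureM _ _ (m0 ai') (h0 bj)).
rewrite (tpureM _ _ (h0 bj') (m0 ai)) (tpureM _ _ (h0 bj') (h0 ai)).
rewrite (tpureM _ _ (m0 bj') (m0 ai)) (tpureM _ _ (m0 bj') (h0 ai)).
rewrite (env_mul mh ai bj) (env_mul mh ai' bj').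
rewrite (env_lieE mh ai bj) (env_lieE mh ai' bj').
rewrite (env_pbrE mh ai bj) (env_pbrE mh ai' bj').
rewrite (env_pbr_antiE mh ai bj) (env_pbr_antiE mh ai' bj').
rewrite (env_mulC m ai bj) (env_mulC m ai' bj').
exact: (bilinear_lie_identity (@tpure_bilinear k D D) (sign_swap k i i' j j')).
Qed.

End TensorEnvelopingPair.
(** * Naturality of tensor maps *)

Section MoreTensorMaps.
Variable k : fieldType.

Lemma tmap_square (U V U1 V1 U2 V2 W X : lmodType k)
    (f : {linear U1 -> W}) (g : {linear V1 -> X})
    (p : {linear U -> U1}) (q : {linear V -> V1})
    (p' : {linear U2 -> W}) (q' : {linear V2 -> X})
    (f' : {linear U -> U2}) (g' : {linear V -> V2}) :
    f \o p =1 p' \o f' -> g \o q =1 q' \o g' ->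
  forall t, tmap f g (tmap p q t) = tmap p' q' (tmap f' g' t).
Proof.
move=> fp gq; elim/tens_span_ind=> [|s t sE tE|u v]; first by rewrite !tmap0.
  by rewrite !tmapD sE tE.
by rewrite !tmapE; have /= -> := fp u; have /= -> := gq v.
Qed.

Lemma tmap_addl (U V U' V' : lmodType k) (f f' : {linear U -> U'})
  (g : {linear V -> V'}) t : tmap (f \+ f') g t = tmap f g t + tmap f' g t.
Proof.
elim/tens_span_ind: t => [|s t sE tE|u v]; first by rewrite !tmap0 addr0.
  by rewrite !tmapD sE tE addrACA.
by rewrite !tmapE /= tpureDl.
Qed.

Lemma tmap_addr (U V U' V' : lmodType k) (f : {linear U -> U'})
  (g g' : {linear V -> V'}) t : tmap f (g \+ g') t = tmap f g t + tmap f g' t.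
Proof.
elim/tens_span_ind: t => [|s t sE tE|u v]; first by rewrite !tmap0 addr0.
  by rewrite !tmapD sE tE addrACA.
by rewrite !tmapE /= tpureDr.
Qed.

Lemma tassoc_natural (U V W U' V' W' : lmodType k) (f : {linear U -> U'})
    (g : {linear V -> V'}) (h : {linear W -> W'}) t :
  tassoc (tmap (tmap f g) h t) = tmap f (tmap g h) (tassoc t).
Proof.
elim/tens_span_ind: t => [|s t sE tE|t w].
- by rewrite !(tmap0, tassoc0).
- by rewrite !(tmapD, tassocD) sE tE.
elim/tens_span_ind: t => [|s t sE tE|u v].
- by rewrite !(tpure0l, tmap0, tassoc0).
- by rewrite !(tpureDl, tmapD, tassocD) sE tE.
by rewrite tassoc_pure !tmapE /= !tmapE tassoc_pure.
Qed.

End MoreTensorMaps.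

(** * The two factors of a tensor product *)

Section TensorFactors.
Variables (k : fieldType) (A B : dgAlgType k).

Lemma diff1 (C : dgAlgType k) : diff (1 : C) = 0.
Proof.
have := diffM 1 (homog1 : homog 0 (1 : C)).
by rewrite !mulr1 mul1r scale1r => /eqP; rewrite -subr_eq0 opprD addNKr oppr_eq0 => /eqP.
Qed.

Definition tinl (a : A) : (A ⊗ B)%type := a ⊗ 1.
Definition tinr (b : B) : (A ⊗ B)%type := 1 ⊗ b.

Lemma tinl_linear : linear tinl.
Proof. by move=> c x y; rewrite /tinl tpureDl tpureZl. Qed.

Lemma tinr_linear : linear tinr.
Proof. by move=> c x y; rewrite /tinr tpureDr tpureZr. Qed.

HB.instance Definition _ :=
  GRing.isLinear.Build k A (A ⊗ B)%type _ tinl tinl_linear.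
HB.instance Definition _ :=
  GRing.isLinear.Build k B (A ⊗ B)%type _ tinr tinr_linear.

Lemma tinl_monoid_morphism : monoid_morphism tinl.
Proof.
split=> // x y; rewrite /tinl; elim/homog_ind: y => [s t sE tE|j y yj].
  by rewrite mulrDr !tpureDl sE tE mulrDr.
by rewrite (tpureM _ _ homog1 yj) mul0r scale1r mulr1.
Qed.

Lemma tinr_monoid_morphism : monoid_morphism tinr.
Proof.
split=> // x y; rewrite /tinr; elim/homog_ind: x => [s t sE tE|j x xj].
  by rewrite mulrDl !tpureDr sE tE mulrDl.
by rewrite (tpureM _ _ xj homog1) mulr0 scale1r mulr1.
Qed.

Lemma tinl_dg : dg_map tinl.
Proof.
split=> [n a an|]; first by rewrite /tinl -[n]addr0; exact: homog_tpure an homog1.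
elim/homog_ind=> [s t sE tE|j a aj]; first by rewrite !linearD /= sE tE.
by rewrite /tinl tens_diffE (tdiff_homog _ aj) diff1 tpure0r scaler0 addr0.
Qed.

Lemma tinr_dg : dg_map tinr.
Proof.
split=> [n a an|b]; first by rewrite /tinr -[n]add0r; exact: homog_tpure homog1 an.
by rewrite /tinr tens_diffE (tdiff_homog _ homog1) diff1 tpure0l scale1r add0r.
Qed.

End TensorFactors.

(** * Uniqueness in the universal property *)

Section UniversalProperty.
Variables (k : fieldType) (A : dgPoissonType k) (Ae : dgAlgType k).
Variables (m : {lrmorphism A -> Ae}) (h : {linear A -> Ae}).

Lemma enveloping_pair_comp (D : dgAlgType k) (phi : {lrmorphism Ae -> D}) :
  dg_map phi -> enveloping_pair m h -> enveloping_pair (phi \o m) (phi \o h).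
Proof.
move=> phi_dg mh; split=> [||i j a b ai bj|i j a b ai bj|i j a b ai bj].
- exact: dg_map_comp (env_dg_f mh).
- exact: dg_map_comp (env_dg_g mh).
- by rewrite /= (env_lie mh ai bj) linearB linearZ /= !rmorphM.
- by rewrite /= (env_pbr mh ai bj) linearB linearZ /= !rmorphM.
- by rewrite /= (env_mul mh ai bj) linearD linearZ /= !rmorphM.
Qed.

(** Both maps are induced by the enveloping pair (psi m, psi h). *)
Lemma enveloping_ext (D : dgAlgType k) (phi psi : {lrmorphism Ae -> D}) :
    is_enveloping m h -> dg_map phi -> dg_map psi ->
    phi \o m =1 psi \o m -> phi \o h =1 psi \o h ->
  phi =1 psi.
Proof.
move=> [mh univ] phi_dg psi_dg eqm eqh.
have [chi [_ chi_uniq]] := univ D _ _ (enveloping_pair_comp psi_dg mh).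
by move=> x; rewrite (chi_uniq phi) // (chi_uniq psi).
Qed.

End UniversalProperty.
(** * Contraction by a functional *)

Section Contractions.
Variable k : fieldType.

Definition contractl (U V : lmodType k) (phi : {linear U -> k^o}) : U ⊗ V -> V :=
  tlift (fun u v => (phi u : k) *: v).
Definition contractr (U V : lmodType k) (phi : {linear V -> k^o}) : U ⊗ V -> U :=
  tlift (fun u v => (phi v : k) *: u).

Lemma contractl_bilinear (U V : lmodType k) (phi : {linear U -> k^o}) :
  bilinear_for *:%R *:%R (fun u (v : V) => (phi u : k) *: v).
Proof.
split=> [v c u u'|u c v v'] /=; first by rewrite linearP scalerDl scalerA.
by rewrite scalerDr !scalerA mulrC.
Qed.

Lemma contractr_bilinear (U V : lmodType k) (phi : {linear V -> k^o}) :
  bilinear_for *:%R *:%R (fun (u : U) v => (phi v : k) *: u).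
Proof.
split=> [v c u u'|u c v v'] /=; last by rewrite linearP scalerDl scalerA.
by rewrite scalerDr !scalerA mulrC.
Qed.

HB.instance Definition _ (U V : lmodType k) (phi : {linear U -> k^o}) :=
  GRing.isLinear.Build k (U ⊗ V)%type V _ (@contractl U V phi)
    (tlift_linear (@contractl_bilinear U V phi)).
HB.instance Definition _ (U V : lmodType k) (phi : {linear V -> k^o}) :=
  GRing.isLinear.Build k (U ⊗ V)%type U _ (@contractr U V phi)
    (tlift_linear (@contractr_bilinear U V phi)).

Lemma contractl0 (U V : lmodType k) (phi : {linear U -> k^o}) :
  contractl phi (0 : U ⊗ V) = 0.
Proof. exact: linear0. Qed.

Lemma contractlD (U V : lmodType k) (phi : {linear U -> k^o}) (s t : (U ⊗ V)%type) :
  contractl phi (s + t) = contractl phi s + contractl phi t.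
Proof. exact: linearD. Qed.

Lemma contractlZ (U V : lmodType k) (phi : {linear U -> k^o}) c (t : (U ⊗ V)%type) :
  contractl phi (c *: t) = c *: contractl phi t.
Proof. exact: linearZ. Qed.

Lemma contractlE (U V : lmodType k) (phi : {linear U -> k^o}) u (v : V) :
  contractl phi (u ⊗ v) = (phi u : k) *: v.
Proof. by rewrite /contractl tlift_pure //; exact: contractl_bilinear. Qed.

Lemma contractr0 (U V : lmodType k) (phi : {linear V -> k^o}) :
  contractr phi (0 : U ⊗ V) = 0.
Proof. exact: linear0. Qed.

Lemma contractrD (U V : lmodType k) (phi : {linear V -> k^o}) (s t : (U ⊗ V)%type) :
  contractr phi (s + t) = contractr phi s + contractr phi t.
Proof. exact: linearD. Qed.

Lemma contractrE (U V : lmodType k) (phi : {linear V -> k^o}) (u : U) v :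
  contractr phi (u ⊗ v) = (phi v : k) *: u.
Proof. by rewrite /contractr tlift_pure //; exact: contractr_bilinear. Qed.

End Contractions.

(** * The counit of a DG Poisson bialgebra *)

Section Counit.
Variables (k : fieldType) (A : dgPoissonType k).
Variables (Delta : {linear A -> (A ⊗ A)%type}) (eps : {linear A -> k^o}).
Hypothesis A_bialg : is_dg_poisson_bialgebra Delta eps.
Let gr_bialg := dgp_bialg_gr A_bialg.

Lemma contractl_Delta a : contractl eps (Delta a) = a.
Proof.
have E t : contractl eps t = contractl (idfun : {linear k^o -> k^o}) (tmap eps idfun t).
  elim/tens_span_ind: t => [|s t sE tE|u v]; first by rewrite tmap0 !contractl0.
    by rewrite tmapD !contractlD sE tE.
  by rewrite tmapE !contractlE.
rewrite E (bialg_counitl gr_bialg) contractlE; exact: scale1r.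
Qed.

Lemma contractr_Delta a : contractr eps (Delta a) = a.
Proof.
have E t : contractr eps t = contractr (idfun : {linear k^o -> k^o}) (tmap idfun eps t).
  elim/tens_span_ind: t => [|s t sE tE|u v]; first by rewrite tmap0 !contractr0.
    by rewrite tmapD !contractrD sE tE.
  by rewrite tmapE !contractrE.
rewrite E (bialg_counitr gr_bialg) contractrE; exact: scale1r.
Qed.

(** A Koszul sign that involves [a] can be dropped next to [eps a]: either [a]
    has degree 0, or [eps a] vanishes. *)
Lemma counit_sign n i (a : A) : homog i a -> (-1) ^ (n * i) * (eps a : k) = eps a.
Proof.
move=> /(bialg_eps_degree0 gr_bialg) /homog_fieldE [->|->].
  by rewrite mulr0 mul1r.
exact: mulr0.
Qed.

(** [contractl eps] followed by [eps] is eps ⊗ eps, so the left side is the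
    value of eps ⊗ eps on the bracket. *)
Lemma counit_tpbr (x y : (A ⊗ A)%type) :
  eps (contractl eps (tpbr x y)) =
    eps (pbr (contractr eps x) (contractr eps y)) +
    eps (pbr (contractl eps x) (contractl eps y)).
Proof.
elim/tens_homog_ind: x => [|s t sE tE|i i' a a' ai ai'].
- by rewrite tpbr0l !(contractl0, contractr0) !linear0l linear0 addr0.
- rewrite tpbrDl !(contractlD, contractrD) !linearDl !linearD sE tE.
  exact: addrACA.
elim/tens_homog_ind: y => [|s t sE tE|j j' b b' bj bj'].
- by rewrite tpbr0r !(contractl0, contractr0) !linear0r linear0 addr0.
- rewrite tpbrDr !(contractlD, contractrD) !linearDr !linearD sE tE.
  exact: addrACA.
rewrite (tpbr_homog _ _ ai' bj) contractlZ contractlD !(contractlE, contractrE).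
rewrite !linearZl_LR !linearZr_LR !linearZ linearD !linearZ /=.
rewrite !(bialg_epsM gr_bialg).
have sa' := counit_sign j ai'; have sb := counit_sign i' bj.
rewrite [j * i']mulrC in sa'.
suff signs (s x y z t P Q : k) : s * x = x -> s * t = t ->
    s * (P * (x * y) + z * t * Q) = x * (y * P) + z * (t * Q).
  exact: signs sa' sb.
by move=> sx st; rewrite -[in RHS]sx -[in RHS]st; ring.
Qed.

(** For [x := Delta a] and [y := Delta b] all four contractions in
    [counit_tpbr] are counit laws, and each of the three terms is eps{a,b}. *)
Lemma counit_pbr a b : eps (pbr a b) = 0.
Proof.
have := counit_tpbr (Delta a) (Delta b).
rewrite -(dgp_bialg_Delta_pbr A_bialg) !contractl_Delta !contractr_Delta.
move=> /eqP; rewrite -subr_eq0 opprD addNKr oppr_eq0 => /eqP //.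
Qed.

Lemma counit_monoid_morphism : monoid_morphism eps.
Proof. by split; [exact: bialg_eps1 gr_bialg | exact: bialg_epsM gr_bialg]. Qed.

Lemma counit_dg : dg_map eps.
Proof.
split; first exact: bialg_eps_degree0 gr_bialg.
by move=> a; rewrite (dgp_bialg_eps_diff A_bialg).
Qed.

Definition counit_lr := lrmorphism_of counit_monoid_morphism.

Lemma counit_enveloping_pair :
  enveloping_pair counit_lr (\0 : {linear A -> k^o}).
Proof.
split=> [||i j a b _ _|i j a b _ _|i j a b _ _] /=.
- exact: counit_dg.
- by split=> [n v _|//]; exact: homog0.
- by rewrite mulr0 scaler0 subr0.
- by rewrite counit_pbr mul0r mulr0 scaler0 subr0.
- by rewrite !mulr0 scaler0 addr0.
Qed.

(** * The enveloping pair of the comultiplication *)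

Lemma Delta_dg : dg_map Delta.
Proof.
split; first exact: bialg_Delta_degree0 gr_bialg.
exact: dgp_bialg_Delta_diff A_bialg.
Qed.

Variables (D : dgAlgType k) (m : {lrmorphism A -> D}) (h : {linear A -> D}).
Hypothesis mh : enveloping_pair m h.

Lemma Delta_env_monoid_morphism : monoid_morphism (tmap m m \o Delta).
Proof.
have [m1 mM] := tmap_monoid_morphism (env_dg_f mh).1 (env_dg_f mh).1.
split=> [|a b] /=; first by rewrite (bialg_Delta1 gr_bialg).
by rewrite (bialg_DeltaM gr_bialg); exact: mM.
Qed.

Definition Delta_env_m := lrmorphism_of Delta_env_monoid_morphism.
Definition Delta_env_h : {linear A -> (D ⊗ D)%type} :=
  (tmap m h \+ tmap h m) \o Delta.

Lemma Delta_enveloping_pair : enveloping_pair Delta_env_m Delta_env_h.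
Proof.
have D0 := bialg_Delta_degree0 gr_bialg.
split=> [||i j a b ai bj|i j a b ai bj|i j a b ai bj].
- exact: dg_map_comp (tmap_dg (env_dg_f mh) (env_dg_f mh)) Delta_dg.
- have [mh0 mhd] := tmap_dg (env_dg_f mh) (env_dg_g mh).
  have [hm0 hmd] := tmap_dg (env_dg_g mh) (env_dg_f mh).
  split=> [n a an|a] /=; first by apply: homogD; [apply: mh0|apply: hm0]; apply: D0.
  by rewrite Delta_dg.2 [RHS]linearD -mhd -hmd.
- rewrite /= (dgp_bialg_Delta_pbr A_bialg).
  exact: (tens_env_lie mh (D0 _ _ ai) (D0 _ _ bj)).
- rewrite /= (dgp_bialg_Delta_pbr A_bialg).
  exact: (tens_env_pbr mh (D0 _ _ ai) (D0 _ _ bj)).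
- rewrite /= (bialg_DeltaM gr_bialg).
  exact: (tens_env_mul mh (D0 _ _ ai) (D0 _ _ bj)).
Qed.

End Counit.

(** * The coderivation law *)

Section Twist.
Variables (k : fieldType) (V W : grModType k).

Lemma twist_linear : linear (@twist k V W).
Proof.
apply: tlift_linear; apply: koszul_bilinear.
by split=> [w c v v'|v c w w'] /=;
  rewrite ?(tpureDl, tpureZl) ?(tpureDr, tpureZr).
Qed.

HB.instance Definition _ := GRing.isLinear.Build k (V ⊗ W)%type (W ⊗ V)%type _
  (@twist k V W) twist_linear.

Lemma twist0 : twist (0 : V ⊗ W) = 0. Proof. exact: linear0. Qed.

Lemma twistD (s t : (V ⊗ W)%type) : twist (s + t) = twist s + twist t.
Proof. exact: linearD. Qed.

Lemma twistZ c (t : (V ⊗ W)%type) : twist (c *: t) = c *: twist t.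
Proof. exact: linearZ. Qed.

End Twist.

(** The sign (-1)^|a| of the second term of [tdiff] is the one produced by
    the two twists, before and after [b] is raised by one degree. *)
Lemma tdiff_twist (k : fieldType) (H : dgAlgType k) (x : (H ⊗ H)%type) :
  tdiff x = tmap diff idfun x + twist (tmap diff idfun (twist x)).
Proof.
elim/tens_homog_ind: x => [|s t sE tE|i j a b ai bj].
- by rewrite (@tdiff0 _ H H) !(twist0, tmap0) addr0.
- by rewrite (@tdiffD _ H H) sE tE !(twistD, tmapD) addrACA.
rewrite (tdiff_homog _ ai) (twist_homog ai bj) tmapZ !tmapE twistZ.
rewrite (twist_homog (diff_homog bj) ai) scalerA; congr (_ + _ *: _).
by rewrite mulrDl mul1r signD mulrA [j * i]mulrC signMM mul1r.
Qed.

(** * Coalgebra laws on the generators *)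

Section Generators.
Variables (k : fieldType) (U V : lmodType k).
Variables (Delta : {linear U -> (U ⊗ U)%type}) (De : {linear V -> (V ⊗ V)%type}).
Variables (m h : {linear U -> V}).
Hypothesis De_m : De \o m =1 tmap m m \o Delta.
Hypothesis De_h : De \o h =1 (tmap m h \+ tmap h m) \o Delta.

(** In terms of the iterated comultiplication of [a], both sides are the image
    under [m ⊗ m ⊗ m], respectively under
    [m ⊗ m ⊗ h + m ⊗ h ⊗ m + h ⊗ m ⊗ m]. *)
Lemma coassoc_generators :
    (forall a, tassoc (tmap Delta idfun (Delta a)) = tmap idfun Delta (Delta a)) ->
  forall a, tassoc (tmap De idfun (De (m a))) = tmap idfun De (De (m a)) /\
            tassoc (tmap De idfun (De (h a))) = tmap idfun De (De (h a)).
Proof.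
move=> Delta_coassoc a; have /= -> := De_m a; have /= -> := De_h a.
have idC (f : {linear U -> V}) : idfun \o f =1 f \o idfun by [].
rewrite !tmapD.
rewrite !(tmap_square De_m (idC _)) !(tmap_square De_h (idC _)) tmap_addl.
rewrite !(tmap_square (idC _) De_m) !(tmap_square (idC _) De_h) tmap_addr.
by rewrite !tassocD !tassoc_natural !Delta_coassoc addrA.
Qed.

Variables (eps : {linear U -> k^o}) (ee : {linear V -> k^o}).
Hypotheses (ee_m : ee \o m =1 eps) (ee_h : ee \o h =1 \0).

Let idC (W : lmodType k) (f : {linear U -> W}) : idfun \o f =1 f \o idfun.
Proof. by []. Qed.
Let ee_mC : ee \o m =1 idfun \o eps. Proof. exact: ee_m. Qed.
Let ee_hC : ee \o h =1 \0 \o eps. Proof. by move=> a; have /= -> := ee_h a. Qed.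

Lemma counitl_generators : (forall a, tmap eps idfun (Delta a) = 1 ⊗ a) ->
  forall a, tmap ee idfun (De (m a)) = 1 ⊗ m a /\
            tmap ee idfun (De (h a)) = 1 ⊗ h a.
Proof.
move=> Delta_counit a; have /= -> := De_m a; have /= -> := De_h a.
rewrite tmapD !(tmap_square ee_mC (idC _)) (tmap_square ee_hC (idC _)).
by rewrite !Delta_counit !tmapE tpure0l addr0.
Qed.

Lemma counitr_generators : (forall a, tmap idfun eps (Delta a) = a ⊗ 1) ->
  forall a, tmap idfun ee (De (m a)) = m a ⊗ 1 /\
            tmap idfun ee (De (h a)) = h a ⊗ 1.
Proof.
move=> Delta_counit a; have /= -> := De_m a; have /= -> := De_h a.
rewrite tmapD !(tmap_square (idC _) ee_mC) (tmap_square (idC _) ee_hC).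
by rewrite !Delta_counit !tmapE tpure0r add0r.
Qed.

End Generators.

(** * The DG bialgebra structure *)

Theorem theorem1p1 (k : fieldType) (k_char0 : [pchar k] =i pred0)
    (A : dgPoissonType k)
    (Delta : {linear A -> (A ⊗ A)%type}) (eps : {linear A -> k^o})
    (A_bialg : is_dg_poisson_bialgebra Delta eps)
    (Ae : dgAlgType k) (m : {lrmorphism A -> Ae}) (h : {linear A -> Ae})
    (Ae_env : is_enveloping m h) :
  exists (Deltae : {linear Ae -> (Ae ⊗ Ae)%type}) (epse : {linear Ae -> k^o}),
    is_dg_bialgebra Deltae epse /\
    [/\ forall a : A, Deltae (m a) = tmap m m (Delta a),
        forall a : A, Deltae (h a) = tmap m h (Delta a) + tmap h m (Delta a),
        forall a : A, epse (m a) = eps a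
      & forall a : A, epse (h a) = 0].
Proof.
have [mh univ] := Ae_env; have gr_bialg := dgp_bialg_gr A_bialg.
have [De [[De_dg De_m De_h] _]] := univ _ _ _ (Delta_enveloping_pair A_bialg mh).
have [ee [[ee_dg ee_m ee_h] _]] := univ _ _ _ (counit_enveloping_pair A_bialg).
have id_dg : dg_map (idfun : Ae -> Ae) by split.
exists De, ee; split; last by split=> a; [exact: De_m|exact: De_h|exact: ee_m|exact: ee_h].
split; last first.
- by move=> a; rewrite -tdiff_twist; exact: De_dg.2.
- by exact: ee_dg.2.
split; [| | |exact: De_dg.1|exact: ee_dg.1|exact: rmorph1|exact: rmorphM
        |exact: rmorph1|exact: rmorphM].
- pose Phi := lrmorphism_of (tmap_monoid_morphism (f := De) (g := idfun) De_dg.1 id_dg.1).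
  pose Psi := lrmorphism_of (tmap_monoid_morphism (f := idfun) (g := De) id_dg.1 De_dg.1).
  pose assoc := lrmorphism_of (tassoc_monoid_morphism Ae Ae Ae).
  have gen := coassoc_generators De_m De_h (bialg_coassoc gr_bialg).
  apply: (enveloping_ext (phi := assoc \o (Phi \o De)) (psi := Psi \o De) Ae_env).
  + apply: dg_map_comp (@tassoc_dg _ Ae Ae Ae) _.
    exact: dg_map_comp (tmap_dg De_dg id_dg) De_dg.
  + exact: dg_map_comp (tmap_dg id_dg De_dg) De_dg.
  + by move=> a; have [] := gen a.
  + by move=> a; have [] := gen a.
- pose Phi := lrmorphism_of (tmap_monoid_morphism (f := ee) (g := idfun) ee_dg.1 id_dg.1).
  pose inr := lrmorphism_of (tinr_monoid_morphism k^o Ae).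
  have gen := counitl_generators De_m De_h ee_m ee_h (bialg_counitl gr_bialg).
  apply: (enveloping_ext (phi := Phi \o De) (psi := inr) Ae_env).
  + exact: dg_map_comp (tmap_dg ee_dg id_dg) De_dg.
  + exact: tinr_dg.
  + by move=> a; have [] := gen a.
  + by move=> a; have [] := gen a.
- pose Phi := lrmorphism_of (tmap_monoid_morphism (f := idfun) (g := ee) id_dg.1 ee_dg.1).
  pose inl := lrmorphism_of (tinl_monoid_morphism Ae k^o).
  have gen := counitr_generators De_m De_h ee_m ee_h (bialg_counitr gr_bialg).
  apply: (enveloping_ext (phi := Phi \o De) (psi := inl) Ae_env).
  + exact: dg_map_comp (tmap_dg id_dg ee_dg) De_dg.
  + exact: tinl_dg.
  + by move=> a; have [] := gen a.
  + by move=> a; have [] := gen a.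
Qed.
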